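(* Let $p>1$, let $P$ be a Borel function on $D\times\partial D$ satisfying (P1) and (P2) (for this $p$), and let $\mathcal F^p$ be a set of continuous functions on $D$ such that: $\|u\|_p<\infty$ for every $u\in\mathcal F^p$; and whenever $u\in\mathcal F^p$ and, for some sequence $r_j\nearrow0$, the sequence $\{u|_{\operatorname{supp}\mu_{r_j}}\}$ has weak limit values $\psi$ with respect to $\{\mu_{r_j}\}$, then $u\le P\psi$ on $D$. Then every $u\in\mathcal F^p$ has boundary values.
   Context: Standing setting: $D$ is a bounded domain in $\mathbb R^n$ exhausted by domains $D_r$, $r<0$, with $D_r\Subset D_s$ for $r<s<0$ and $\bigcup_{r<0}D_r=D$; $S_r=\partial D_r$. For each $r<0$, $\mu_r$ is a finite positive regular Borel measure supported on $S_r$, and $\mu_r\to\mu$ weak-* in $C(\overline D)^*$ as $r\to0^-$, where $\mu$ is a finite positive measure supported on $\partial D$; $K_0=\operatorname{supp}\mu$. For a sequence $r_j\nearrow0$ and functions $\phi_j$ on $\operatorname{supp}\mu_{r_j}$: $\{\phi_j\}$ has weak limit values $\phi_*$ (a $\mu$-integrable function on $K_0$) if $\int\!h\phi_j\,d\mu_{r_j}\to\int_{K_0}h\phi_*\,d\mu$ for all $h\in C(\overline D)$; $\{\phi_j\}$ has strong limit values $\phi^*$ (a real $\mu$-measurable function on $K_0$) if for all real $a<b$ and $\varepsilon,\delta>0$ there are $j_0$ and an open set $O\subset\overline D$ containing $\{x\in K_0:a\le\phi^*(x)<b\}$ with $\mu_{r_j}(\{\phi_j<a-\varepsilon\}\cap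 O)+\mu_{r_j}(\{\phi_j>b+\varepsilon\}\cap O)<\delta$ for $j\ge j_0$. A function $u$ on $D$ has boundary values $u^*$ if for every sequence $r_j\nearrow0$ the sequence $\{u|_{\operatorname{supp}\mu_{r_j}}\}$ has strong limit values with respect to $\{\mu_{r_j}\}$, equal to $u^*$ ($\mu$-a.e.) independently of the sequence. For $u$ on $D$, $\|u\|_p=\limsup_{r\to0^-}\int_{S_r}|u|^p\,d\mu_r$. For a function $h$ on $\partial D$, $Ph(z)=\int_{\partial D}h(\zeta)P(z,\zeta)\,d\mu(\zeta)$. Conditions: (P1) $\int_{\partial D}P(z,\zeta)\,d\mu(\zeta)=1$ for all $z\in D$; (P2) for every $h\in L^p(K_0,\mu)$ the function $Ph$ has boundary values equal to $h$ and $\|Ph\|_p\le\|h\|_{L^p(K_0,\mu)}$. *)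

(* Defs.v *)
From HB Require Import structures.
From mathcomp Require Import all_boot all_order all_algebra.
From mathcomp Require Import all_classical all_reals all_analysis.

Set Implicit Arguments.
Unset Strict Implicit.
Unset Printing Implicit Defensive.

Import Order.TTheory GRing.Theory Num.Theory.
Import numFieldNormedType.Exports.

Local Open Scope classical_set_scope.
Local Open Scope ring_scope.

Definition Bn (R : realType) (n : nat) := g_sigma_algebraType (@open 'rV[R]_n).

Section Defs.
Context {R : realType} {n : nat}.
Local Notation V := 'rV[R]_n.
Local Notation B := (Bn R n).

Definition domain (A : set V) := open A /\ connected A /\ A !=set0.

Definition bdry (A : set V) : set V := closure A `\` interior A.

Definition supp (m : {measure set B -> \bar R}) : set V :=
  [set x | forall U : set V, open U -> U x -> (0 < m U)%E].

Definition seq_to0 (r : nat -> R) :=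
  (forall j, r j < 0) /\ nondecreasing_seq r /\ r @ \oo --> (0:R).

(* f is mu-measurable on A (measurable for the completion of mu):
   it agrees with a Borel function outside a mu-null set *)
Definition mu_measurable (mu : {measure set B -> \bar R}) (A : set V) (f : V -> R) :=
  exists g : B -> R, measurable_fun (A : set B) g /\
    mu.-negligible ([set x | A x /\ f x <> g x] : set B).

Definition weak_limit (D : set V) (mur : R -> {measure set B -> \bar R})
  (mu : {measure set B -> \bar R}) (r : nat -> R) (phi : nat -> V -> R)
  (psi : V -> R) :=
  mu.-integrable (supp mu : set B) (EFin \o psi) /\
  (forall j, (mur (r j)).-integrable (supp (mur (r j)) : set B) (EFin \o phi j)) /\
  forall h : V -> R, {within closure D, continuous h} ->
    (fun j => (\int[mur (r j)]_(x in (supp (mur (r j)) : set B)) (h x * phi j x)%:E)%E)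
      @ \oo --> (\int[mu]_(x in (supp mu : set B)) (h x * psi x)%:E)%E.

(* strong limit values phis of {phi_j} wrt {mu_{r_j}};
   an open subset O of closure D is written O = U `&` closure D with U open *)
Definition strong_limit (D : set V) (mur : R -> {measure set B -> \bar R})
  (mu : {measure set B -> \bar R}) (r : nat -> R) (phi : nat -> V -> R)
  (phis : V -> R) :=
  mu_measurable mu (supp mu) phis /\
  forall a b eps delta : R, a < b -> 0 < eps -> 0 < delta ->
    exists j0 : nat, exists U : set V, open U /\
      [set x | supp mu x /\ a <= phis x < b] `<=` U /\
      forall j, (j0 <= j)%N ->
        (mur (r j) (supp (mur (r j)) `&` (U `&` closure D)
                      `&` [set x | (phi j x < a - eps)%R])
         + mur (r j) (supp (mur (r j)) `&` (U `&` closure D)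
                      `&` [set x | (b + eps < phi j x)%R]) < delta%:E)%E.

Definition is_boundary_values (D : set V) (mur : R -> {measure set B -> \bar R})
  (mu : {measure set B -> \bar R}) (u ustar : V -> R) :=
  mu_measurable mu (supp mu) ustar /\
  forall r : nat -> R, seq_to0 r ->
    exists phis : V -> R, strong_limit D mur mu r (fun _ => u) phis /\
      {ae mu, forall x : B, supp mu x -> phis x = ustar x}.

Definition has_boundary_values (D : set V) (mur : R -> {measure set B -> \bar R})
  (mu : {measure set B -> \bar R}) (u : V -> R) :=
  exists ustar, is_boundary_values D mur mu u ustar.

(* ||u||_p = limsup_{r -> 0-} int_{S_r} |u|^p d mu_r  (no p-th root) *)
Definition norm_p (Dr : R -> set V) (mur : R -> {measure set B -> \bar R})
  (p : R) (u : V -> R) : \bar R :=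
  let I := fun r => (\int[mur r]_(x in (bdry (Dr r) : set B)) (`|u x| `^ p)%:E)%E in
  ereal_inf [set ereal_sup [set I r | r in [set r : R | - e < r < 0]]
            | e in [set e : R | 0 < e]].

Definition Pop (mu : {measure set B -> \bar R}) (P : V -> V -> R) (h : V -> R)
  : V -> R :=
  fun z => fine (\int[mu]_(x in (supp mu : set B)) (h x * P z x)%:E)%E.

Definition in_Lp (mu : {measure set B -> \bar R}) (p : R) (h : V -> R) :=
  measurable_fun (supp mu : set B) (h : B -> R) /\
  (\int[mu]_(x in (supp mu : set B)) (`|h x| `^ p)%:E < +oo)%E.

Definition Lp_pow (mu : {measure set B -> \bar R}) (p : R) (h : V -> R) :=
  (\int[mu]_(x in (supp mu : set B)) (`|h x| `^ p)%:E)%E.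

End Defs.

(* Main.v *)
(** Let [u] be in [F].  The bound on [norm_p u] gives weak compactness in L^p: along a
    subsequence of any [r_j], [u] has weak limit values [psi] in L^p(mu), hence [u <= w] on [D]
    with [w = P psi], and [w] has boundary values [psi] by (P2).  Since [p > 1], the L^p bounds
    give uniform integrability, so strong limit values imply convergence of means:
    [\int w dmu_r --> \int psi dmu] along every sequence.  If [psi'] are the weak limit values of
    [u] along another sequence and [w' = P psi'], comparing the means in [u <= w] along the second
    sequence and in [u <= w'] along the first yields [\int psi' <= \int psi <= \int psi'].  Thus
    [\int (w - u) dmu_r --> 0] along every sequence; as [w - u >= 0], Markov's inequality shows
    that [u] inherits the strong limit values of [w].

    For weak compactness, a diagonal argument makes [\int h u dmu_{r_j}] converge for a countable
    family of continuous [h] built on rational balls.  Young's inequality makes the limit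
    functional L^q(mu)-continuous, so it extends to bounded Borel functions; on indicators it is
    a charge dominated by [mu], and its Radon-Nikodym derivative is the weak limit. *)

Require Import Defs.
From HB Require Import structures.
From mathcomp Require Import all_boot all_order all_algebra.
From mathcomp Require Import all_classical all_reals all_analysis.
From mathcomp Require Import measurable_realfun lra ring.
Import Order.TTheory GRing.Theory Num.Theory.
Import numFieldNormedType.Exports.
Local Open Scope classical_set_scope.
Local Open Scope ring_scope.
Set Implicit Arguments.
Unset Strict Implicit.
Unset Printing Implicit Defensive.

(** * Borel sets and bumps on rational balls *)


(** The measures [mur r] and [mu] may be carried by disjoint sets, so functions cannot be compared
    pointwise across them: continuous test functions are the only link. This shapes both halves of
    the proof. For weak limits, estimates against [mur r] reach [mu] because |h|^q is a test
    function whenever h is one. For strong limits, [psi] is replaced by a continuous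
    L^1(mu)-approximation, with which [w] is compared in measure. Young's inequality carries a free
    scale [t] instead of being optimised into Hölder's: the term with the L^p bound of [u] becomes
    [t^p * C] and is made small by the choice of [t], so no roots of integrals occur. Functions
    given on [D] are extended by 0 as [u \_ D]. For r < 0 the boundary of [Dr r] lies in [D], so
    [mur r] does not see the extension. *)

Section Borel.
Context {R : realType} {n : nat}.
Local Notation V := 'rV[R]_n.
Local Notation B := (Bn R n).

Lemma open_measurable_Bn (U : set V) : open U -> measurable (U : set B).
Proof. by move=> oU; apply: sub_sigma_algebra. Qed.

Lemma closed_measurable_Bn (U : set V) : closed U -> measurable (U : set B).
Proof.
move=> cU; rewrite -(setCK U); apply: measurableC; apply: open_measurable_Bn.
exact: closed_openC.
Qed.

Lemma within_open_measurable (D : set V) (u : V -> R) :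
  open D -> {within D, continuous u} -> measurable_fun (D : set B) (u : B -> R).
Proof.
move=> oD cu; apply: (measurability _ (measurable_realfun.RGenOInfty.measurableE R)).
move=> /= _ [_ [a ->] <-]; apply: open_measurable_Bn.
rewrite openE => x [Dx ux].
have := cu; rewrite continuous_open_subspace// => /(_ x (mem_set Dx)) ucx.
have := ucx _ (open_nbhs_nbhs (conj (@open_gt _ a) _)).
rewrite /= in_itv/= andbT in ux; move=> /(_ ux) h.
have Dn : nbhs x D by apply: open_nbhs_nbhs.
rewrite /interior; near=> y; split; first by near: y.
by rewrite /= in_itv/= andbT; near: y; exact: h.
Unshelve. all: by end_near. Qed.

Lemma continuous_measurable (u : V -> R) :
  continuous u -> measurable_fun setT (u : B -> R).
Proof.
move=> cu; apply: within_open_measurable; first exact: openT.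
exact: continuous_subspaceT.
Qed.

Lemma measurable_patch (D : set V) (u : V -> R) :
  open D -> measurable_fun (D : set B) (u : B -> R) ->
  measurable_fun setT (u \_ D : B -> R).
Proof.
by move=> /open_measurable_Bn mD mu; exact: (proj1 (@measurable_restrictT _ _ (Bn R n) R D u mD)).
Qed.

End Borel.

Section RealContinuity.
Context {R : realType} {T : topologicalType}.
Implicit Types f g : T -> R.

Lemma cts_cst (c : R) : continuous (fun _ : T => c).
Proof. by move=> x; exact: cvg_cst. Qed.

Lemma ctsD f g : continuous f -> continuous g ->
  continuous (fun x => f x + g x).
Proof. by move=> cf cg x; apply: cvgD; [exact: cf|exact: cg]. Qed.

Lemma ctsB f g : continuous f -> continuous g ->
  continuous (fun x => f x - g x).
Proof. by move=> cf cg x; apply: cvgB; [exact: cf|exact: cg]. Qed.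

Lemma ctsM f g : continuous f -> continuous g ->
  continuous (fun x => f x * g x).
Proof. by move=> cf cg x; apply: cvgM; [exact: cf|exact: cg]. Qed.

Lemma cts_norm f : continuous f -> continuous (fun x => `|f x|).
Proof. by move=> cf x; apply: cvg_norm; exact: cf. Qed.

Lemma cts_min f g : continuous f -> continuous g ->
  continuous (fun x => Num.min (f x) (g x)).
Proof. by move=> cf cg x; exact: (@continuous_min R T f g x (cf x) (cg x)). Qed.

Lemma cts_max f g : continuous f -> continuous g ->
  continuous (fun x => Num.max (f x) (g x)).
Proof. by move=> cf cg x; exact: (@continuous_max R T f g x (cf x) (cg x)). Qed.

End RealContinuity.

Section Bump.
Context {R : realType} {n : nat}.
Local Notation V := 'rV[R]_n.
Local Notation B := (Bn R n).

Definition ball_bump (c : V) (r : R) (k : nat) (x : V) : R :=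
  Num.min 1 (k%:R * Num.max 0 (r - `|x - c|)).

Lemma continuous_ball_bump c r k : continuous (ball_bump c r k).
Proof.
apply: cts_min; first exact: cts_cst.
apply: ctsM; first exact: cts_cst.
apply: cts_max; first exact: cts_cst.
apply: ctsB; first exact: cts_cst.
have cs : continuous (fun y : V => y - c).
  by move=> y; apply: (@cvgB R V V (nbhs y) _ idfun (cst c)); [exact: cvg_id|exact: cvg_cst].
by move=> x; apply: (continuous_comp (cs x)); exact: norm_continuous.
Qed.

Lemma ball_bump_ge0 c r k x : 0 <= ball_bump c r k x.
Proof. by rewrite /ball_bump le_min ler01/= mulr_ge0// le_max lexx. Qed.

Lemma ball_bump_le1 c r k x : ball_bump c r k x <= 1.
Proof. by rewrite /ball_bump ge_min lexx. Qed.

Lemma ball_bump_out c r k x : ~ (`|x - c| < r) -> ball_bump c r k x = 0.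
Proof.
move=> /negP; rewrite -leNgt => h.
by rewrite /ball_bump max_l ?subr_le0// mulr0 min_r.
Qed.

Lemma ball_bump_in c r x : `|x - c| < r -> \forall k \near \oo, ball_bump c r k x = 1.
Proof.
move=> h; near=> k; rewrite /ball_bump; apply: min_idPl.
rewrite max_r; last by rewrite subr_ge0 ltW.
rewrite -ler_pdivrMr ?subr_gt0// div1r.
by near: k; exact: nbhs_infty_ger.
Unshelve. all: by end_near. Qed.

Lemma cvg_ball_bump c r x : ball_bump c r k x @[k --> \oo] --> (((`|x - c| < r)%R)%:R : R).
Proof.
have [h|/negP h] := boolP (`|x - c| < r); first exact: cvg_near_cst (ball_bump_in h).
by under eq_fun do rewrite ball_bump_out//; exact: cvg_cst.
Qed.

(** Lists of balls, because the limit sets [ball_cap s] must be stable under intersection for the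
    pi-lambda argument. *)
Definition bumps (s : seq (V * R)) (k : nat) (x : V) : R :=
  \prod_(cr <- s) ball_bump cr.1 cr.2 k x.

Lemma continuous_bumps s k : continuous (bumps s k).
Proof.
elim: s => [|a s IH] x.
  by under [bumps _ _]eq_fun do rewrite /bumps big_nil; exact: cst_continuous.
have -> : bumps (a :: s) k = (fun x => ball_bump a.1 a.2 k x * bumps s k x).
  by apply/funext => y; rewrite /bumps big_cons.
apply: continuousM; [exact: continuous_ball_bump|exact: IH].
Qed.

Lemma bumps_itv s k x : 0 <= bumps s k x <= 1.
Proof.
rewrite /bumps; elim: s => [|a s /andP[s0 s1]]; first by rewrite big_nil ler01 lexx.
by rewrite big_cons mulr_ge0 ?ball_bump_ge0//= mulr_ile1 ?ball_bump_ge0 ?ball_bump_le1.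
Qed.

Definition ball_cap (s : seq (V * R)) : set V :=
  [set x | all (fun cr => `|x - cr.1| < cr.2) s].

Lemma cvg_bumps s x : bumps s k x @[k --> \oo] --> (\1_(ball_cap s) x : R).
Proof.
elim: s => [|a s IH].
  rewrite /bumps; under eq_fun do rewrite big_nil.
  by rewrite indicE mem_set//; exact: cvg_cst.
have -> : (fun k => bumps (a :: s) k x) =
    (fun k => ball_bump a.1 a.2 k x * bumps s k x).
  by apply/funext => k; rewrite /bumps big_cons.
have -> : \1_(ball_cap (a :: s)) x = ((`|x - a.1| < a.2)%R)%:R * \1_(ball_cap s) x :> R.
  rewrite !indicE -natrM mulnb; congr (nat_of_bool _)%:R.
  by apply/idP/idP => [/set_mem/= /andP[-> h]|/andP[h /set_mem/= h']];
    apply/mem_set => //=; apply/andP.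
apply: cvgM => //; exact: cvg_ball_bump.
Qed.

End Bump.

Section RationalBalls.
Context {R : realType} {n : nat}.
Local Notation V := 'rV[R]_n.
Local Notation B := (Bn R n).
Local Notation Q := ('rV[rat]_n * rat)%type.

Definition ratmx (c : 'rV[rat]_n) : V := map_mx ratr c.

Definition ratpair (p : Q) : V * R := (ratmx p.1, ratr p.2).

(** Rational centres and radii keep the family countable, so that one diagonal subsequence can treat
    all its members. *)
Definition rbumps (s : seq Q) (k : nat) : V -> R := bumps (map ratpair s) k.

Definition rcap (s : seq Q) : set V := ball_cap (map ratpair s).

Lemma rat_ball_basis (U : set V) x : open U -> U x -> exists p : Q,
  `|x - ratmx p.1| < ratr p.2 /\ forall y, `|y - ratmx p.1| < ratr p.2 -> U y.
Proof.
move=> oU Ux.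
have /nbhs_ballP[e /= e0 eU] : nbhs x U by exact: open_nbhs_nbhs.
(* A rational radius between [e / 4] and [e / 2] and a centre within [e / 4] of [x] in every
   coordinate, which suffices for the sup norm: the ball contains [x] and has diameter below [e]. *)
have e4 : 0 < e / 4 by rewrite divr_gt0.
have /rat_in_itvoo[r] : e / 4 < e / 2 by lra.
rewrite in_itv/= => /andP[r1 r2].
have /choice[c hc] : forall i : 'I_n, exists q : rat, `|x ord0 i - ratr q| < e / 4.
  move=> i; have /rat_in_itvoo[q] : x ord0 i - e / 4 < x ord0 i + e / 4 by lra.
  rewrite in_itv/= => /andP[q1 q2]; exists q.
  by rewrite ltr_norml; apply/andP; split; lra.
have xc : `|x - ratmx (\row_i c i)| < ratr r.
  apply: lt_trans r1.
  suff : ball x (e / 4) (ratmx (\row_i c i)) by rewrite -ball_normE.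
  by split => // i j; rewrite !mxE ord1 -ball_normE; exact: hc.
exists (\row_i c i, r); split=> //= y yc; apply: eU.
rewrite -ball_normE/=.
have -> : x - y = (x - ratmx (\row_i c i)) - (y - ratmx (\row_i c i)).
  by rewrite opprB addrA subrK.
rewrite (le_lt_trans (ler_normB _ _))//; lra.
Qed.

Lemma open_rat_bigcup (U : set V) : open U ->
  exists F : nat -> Q, exists P : set nat,
    U = \bigcup_(k in P) [set y | `|y - ratmx (F k).1| < ratr (F k).2].
Proof.
move=> oU.
pose F k : Q := odflt (0, 0) (unpickle k).
exists F; exists [set k | forall y, `|y - ratmx (F k).1| < ratr (F k).2 -> U y].
apply/seteqP; split => [x Ux|x [k /= h]]; last exact: h.
have [p [px pU]] := rat_ball_basis oU Ux.
by exists (pickle p); rewrite /= /F pickleK/=.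
Qed.

Lemma open_rat_ball (p : Q) : open [set y : V | `|y - ratmx p.1| < ratr p.2].
Proof.
rewrite (_ : [set _ | _] = ball (ratmx p.1) (ratr p.2)); first exact: ball_open.
by apply/seteqP; split => y; rewrite -ball_normE/= distrC.
Qed.

Lemma measurable_rcap s : measurable (rcap s : set B).
Proof.
elim: s => [|p s IH].
  rewrite (_ : rcap [::] = setT); first exact: measurableT.
  by apply/seteqP; split.
rewrite (_ : rcap (p :: s) =
    [set y | `|y - ratmx p.1| < ratr p.2] `&` rcap s); last first.
  by apply/seteqP; split => [y /andP//|y [? ?]]; apply/andP.
by apply: measurableI => //; apply: open_measurable_Bn; exact: open_rat_ball.
Qed.

Lemma rcap_setI s t : rcap s `&` rcap t = rcap (s ++ t).
Proof.
by apply/seteqP; split => [y [ys yt]|y]; rewrite /rcap /ball_cap/= map_cat all_cat;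
  [apply/andP|move=> /andP].
Qed.

(** Open sets are countable unions of rational balls, so this pi-system generates the Borel sets. *)
Lemma Bn_measurableE : @measurable _ B = <<s range rcap >>.
Proof.
apply/seteqP; split => A; apply: smallest_sub.
- exact: smallest_sigma_algebra.
- move=> U oU; have [F [P ->]] := open_rat_bigcup oU.
  have -> : \bigcup_(k in P) [set y | `|y - ratmx (F k).1| < ratr (F k).2] =
    \bigcup_(k in P) rcap [:: F k].
    by apply: eq_bigcupr => k _; apply/seteqP; split => y; rewrite /rcap /ball_cap/= andbT.
  apply: (@bigcup_measurable _ (g_sigma_algebraType (range rcap))) => k _.
  by apply: sub_sigma_algebra; exists [:: F k].
- exact: (@sigma_algebra_measurable _ B).
- by move=> _ [s _ <-]; exact: measurable_rcap.
Qed.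

End RationalBalls.

(** * The functional monotone class theorem *)



Section BoundedMeasurableInd.
Import HBSimple HBNNSimple.
Context d (T : measurableType d) (R : realType).
Variable E : set (T -> R).
Hypothesis E_lin : forall (a : R) f g, E f -> E g -> E (fun x => a * f x + g x).
Hypothesis E_indic : forall A : set T, measurable A -> E (\1_A).
Hypothesis E_lim : forall (f_ : nat -> T -> R) f (c : R), (forall k, E (f_ k)) ->
  (forall k x, `|f_ k x| <= c) -> (forall x, f_ ^~ x @ \oo --> f x) -> E f.

Let E0 : E (fun=> 0).
Proof.
rewrite (_ : (fun=> 0) = \1_set0); first exact: E_indic.
by apply/funext => x; rewrite indic0.
Qed.

Let E1 : E (fun=> 1).
Proof.
rewrite (_ : (fun=> 1) = \1_setT); first exact: E_indic.
by apply/funext => x; rewrite indicT.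
Qed.

Let E_nnsfun (f : {nnsfun T >-> R}) : E (fun x => f x).
Proof.
have -> : (fun x => f x) = (fun x =>
    \sum_(r <- finmap.enum_fset (fset_set (range f))) r * \1_(f @^-1` [set r]) x).
  by apply/funext => x; rewrite [LHS]fimfunE fsbig_finite.
elim: (finmap.enum_fset (fset_set (range f))) => [|r s IH].
  by under eq_fun do rewrite big_nil.
under eq_fun do rewrite big_cons.
by apply: E_lin => //; apply: E_indic; exact: measurable_sfunP.
Qed.

(** Serves twice: with indicators reached from continuous functions by Dynkin's theorem, and with
    indicators on which a charge is given by its density. *)
Lemma bounded_measurable_ind (f : T -> R) (c : R) :
  measurable_fun setT f -> (forall x, `|f x| <= c) -> E f.
Proof.
move=> mf fc.
(* After the shift the values lie in [[0, 2 * c]], and the simple approximations from below share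
   the bound that [E_lim] demands. *)
pose g (x : T) : R := f x + c.
have g0 x : 0 <= g x by move: (fc x); rewrite /g ler_norml => /andP[? _]; lra.
have g2 x : g x <= 2 * c by move: (fc x); rewrite /g ler_norml => /andP[_ ?]; lra.
have mg : measurable_fun setT (EFin \o g).
  by apply/measurable_EFinP; apply: measurable_funD => //; exact: measurable_cst.
pose h := nnsfun_approx measurableT mg.
have Eg : E g.
  apply: (@E_lim (fun k x => h k x) _ (2 * c)) => //.
    move=> k x; have hk := @fun_ge0 _ _ (h k) x; rewrite ger0_norm//.
    apply: le_trans (g2 x); rewrite -lee_fin /h nnsfun_approxE.
    exact: (le_approx k (fun y _ => g0 y : (0 <= (EFin \o g) y)%E)).
  by move=> x; have /fine_cvgP[_] :=
    cvg_nnsfun_approx measurableT mg (fun y _ => g0 y : (0 <= (EFin \o g) y)%E) (I : setT x).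
have -> : f = (fun x => - c * 1 + g x).
  by apply/funext => x; rewrite /g; ring.
exact: E_lin.
Qed.

End BoundedMeasurableInd.

Section MonotoneClass.
Context {R : realType} {n : nat}.
Local Notation V := 'rV[R]_n.
Local Notation B := (Bn R n).
Variable E : set (V -> R).
Hypothesis E_lin : forall (a : R) f g, E f -> E g -> E (fun x => a * f x + g x).
Hypothesis E_bumps : forall s k, E (rbumps s k).
Hypothesis E_lim : forall (f_ : nat -> V -> R) f (c : R), (forall k, E (f_ k)) ->
  (forall k x, `|f_ k x| <= c) -> (forall x, f_ ^~ x @ \oo --> f x) -> E f.

Let E_indic_cap s : E (\1_(rcap s)).
Proof.
apply: (@E_lim (rbumps s) _ 1); first exact: E_bumps.
  by move=> k x; have /andP[? ?] := bumps_itv (map ratpair s) k x; rewrite ger0_norm.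
by move=> x; exact: cvg_bumps.
Qed.

Let E1 : E (fun=> 1).
Proof.
have -> : (fun=> 1) = rbumps [::] 0 :> (V -> R).
  by apply/funext => x; rewrite /rbumps /bumps big_nil.
exact: E_bumps.
Qed.

Let E0 : E (fun=> 0).
Proof.
have := E_lin (-1) E1 E1; rewrite (_ : (fun _ => _) = (fun=> 0))//.
by apply/funext => x; rewrite mulr1 addNr.
Qed.

(** Complements are handled as 1 - 1_S, disjoint unions as bounded pointwise limits of finite sums
    of indicators. *)
Let E_indic (A : set B) : measurable A -> E (\1_A).
Proof.
rewrite Bn_measurableE.
apply: (@dynkin_induction _ B (range rcap) (fun A => E (\1_A))).
- exact: Bn_measurableE.
- by move=> _ _ [s _ <-] [t _ <-]; exists (s ++ t) => //; rewrite rcap_setI.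
- by have -> : \1_[set: V] = (fun=> 1) :> (V -> R) by apply/funext => x; rewrite indicT.
- by move=> _ [s _ <-].
- move=> S _ ES; have -> : \1_(~` S) = (fun x => -1 * \1_S x + 1) :> (V -> R).
    by apply/funext => x; rewrite !indicE in_setC; case: (x \in S); rewrite /=; ring.
  exact: E_lin.
- move=> F mF tF EF.
  have EU k : E (\1_(\big[setU/set0]_(i < k) F i)).
    elim: k => [|k IH].
      rewrite big_ord0 (_ : \1_set0 = (fun=> 0))//.
      by apply/funext => x; rewrite indic0.
    have -> : \1_(\big[setU/set0]_(i < k.+1) F i) =
        (fun x => 1 * \1_(F k) x + \1_(\big[setU/set0]_(i < k) F i) x) :> (V -> R).
      apply/funext => x; rewrite big_ord_recr/= mul1r !indicE in_setU.
      have [xF|] := boolP (x \in F k); last by rewrite orbF add0r.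
      rewrite orbT (_ : (x \in _) = false) ?addr0//.
      apply/negbTE/negP => /set_mem; rewrite -bigcup_mkord => -[i /= ik Fi].
      have /trivIsetP/(_ i k Logic.I Logic.I) := tF.
      rewrite (ltn_eqF ik) => /(_ isT) /seteqP[h _].
      by have := h x; apply; split => //; exact/set_mem.
    exact: E_lin.
  apply: (@E_lim (fun k => \1_(\big[setU/set0]_(i < k) F i)) _ 1) => //.
    by move=> k x; rewrite indicE; case: (_ \in _); rewrite ?normr0 ?normr1.
  move=> x; apply: cvg_near_cst.
  have [xF|xF] := boolP (x \in \bigcup_k F k).
    have [i _ Fi] := set_mem xF.
    near=> k; rewrite !indicE xF mem_set//.
    rewrite -bigcup_mkord; exists i => //=.
    by near: k; exact: nbhs_infty_gt.
  near=> k; rewrite !indicE (negbTE xF) (_ : (x \in _) = false)//.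
  apply/negbTE; move: xF; apply: contra => /set_mem.
  by rewrite -bigcup_mkord => -[i _ Fi]; apply/mem_set; exists i.
Unshelve. all: by end_near. Qed.

Lemma functional_monotone_class (f : V -> R) (c : R) :
  measurable_fun setT (f : B -> R) -> (forall x, `|f x| <= c) -> E f.
Proof. exact: (@bounded_measurable_ind _ B R E E_lin E_indic E_lim). Qed.

End MonotoneClass.



(** * Truncation, finite measures and density of continuous functions *)

Definition clamp {R : realType} (N x : R) : R := Num.max (- N) (Num.min N x).

Section Clamp.
Context {R : realType}.
Implicit Types N x y : R.

Lemma clamp_norm N x : 0 <= N -> `|clamp N x| <= N.
Proof.
move=> N0; rewrite /clamp /Num.min /Num.max ler_norml.
by case: (ltP N x) => a; case: (ltP (- N) N) => c; case: (ltP (- N) x) => e; apply/andP; split; lra.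
Qed.

Lemma clamp_lip N x y : 0 <= N -> `|clamp N x - clamp N y| <= `|x - y|.
Proof.
move=> N0.
have h1 : x - y <= `|x - y| by exact: ler_norm.
have h2 : y - x <= `|x - y| by rewrite distrC; exact: ler_norm.
have h3 : 0 <= `|x - y| by [].
move: `|x - y| h1 h2 h3 => r h1 h2 h3; rewrite ler_norml /clamp /Num.min /Num.max.
by case: (ltP N x) => a; case: (ltP N y) => b; case: (ltP (- N) N) => c;
  case: (ltP (- N) x) => e; case: (ltP (- N) y) => f; apply/andP; split; lra.
Qed.

Lemma clamp_id N x : `|x| <= N -> clamp N x = x.
Proof.
rewrite ler_norml /clamp /Num.min /Num.max => /andP[? ?].
by case: (ltP N x) => a; case: (ltP (- N) N) => c; case: (ltP (- N) x) => e; lra.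
Qed.

Lemma clamp_dist N x : 0 <= N -> `|x - clamp N x| <= `|x|.
Proof.
move=> N0; have := clamp_lip x 0 N0; rewrite subr0.
rewrite [clamp N 0]clamp_id ?normr0// subr0 => _.
rewrite /clamp /Num.min /Num.max.
have h1 : x <= `|x| by exact: ler_norm.
have h2 : - x <= `|x| by rewrite -normrN; exact: ler_norm.
move: `|x| h1 h2 => r h1 h2; rewrite ler_norml.
by case: (ltP N x) => a; case: (ltP (- N) N) => c; case: (ltP (- N) x) => e; apply/andP; split; lra.
Qed.

(** If |x| > N, then |x| is at most |x| * (|x| / N)^(p - 1). This is the uniform integrability
    estimate: an L^p bound makes the tails of order N^(1 - p). *)
Lemma clamp_dist_powR N x (p : R) : 0 < N -> 1 < p ->
  `|x - clamp N x| <= (N `^ (p - 1))^-1 * `|x| `^ p.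
Proof.
move=> N0 p1; have [xN|Nx] := leP `|x| N.
  by rewrite clamp_id// subrr normr0 mulr_ge0 ?invr_ge0 ?powR_ge0.
apply: le_trans (clamp_dist x (ltW N0)) _.
rewrite -ler_pdivrMl ?invr_gt0 ?powR_gt0// invrK.
rewrite -(mulr_powRB1 (x := `|x|)) ?(lt_trans _ p1)// mulrC ler_wpM2l//.
by rewrite ge0_ler_powR ?nnegrE ?subr_ge0 1?ltW// (lt_trans N0).
Qed.

Lemma cvg_clamp x : clamp k%:R x @[k --> \oo] --> x.
Proof.
apply: cvg_near_cst; near=> k; apply: clamp_id.
by near: k; exact: nbhs_infty_ger.
Unshelve. all: by end_near. Qed.

Lemma cts_clamp {T : topologicalType} N (f : T -> R) :
  continuous f -> continuous (fun x : T => clamp N (f x)).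
Proof.
by move=> cf; apply: cts_max; [exact: cts_cst|apply: cts_min; [exact: cts_cst|]].
Qed.

Lemma measurable_clamp d (T : measurableType d) N (f : T -> R) :
  measurable_fun setT f -> measurable_fun setT (fun x : T => clamp N (f x)).
Proof.
move=> mf; apply: measurable_maxr; first exact: measurable_cst.
by apply: measurable_minr => //; exact: measurable_cst.
Qed.

Lemma le1D_powR x (p : R) : 1 < p -> `|x| <= 1 + `|x| `^ p.
Proof.
move=> p1; have [x1|x1] := leP `|x| 1.
  by rewrite (le_trans x1)// lerDl powR_ge0.
by rewrite (le_trans (le1r_powR (ltW x1) (ltW p1)))// lerDr.
Qed.

End Clamp.

Lemma measurable_set_le d (T : measurableType d) (R : realType) (f g : T -> R) :
  measurable_fun setT f -> measurable_fun setT g ->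
  measurable [set x | f x <= g x].
Proof.
by move=> mf mg; rewrite -[X in measurable X]setTI; exact: measurable_fun_le.
Qed.

Lemma measurable_set_lt d (T : measurableType d) (R : realType) (f g : T -> R) :
  measurable_fun setT f -> measurable_fun setT g ->
  measurable [set x | f x < g x].
Proof.
move=> mf mg; rewrite (_ : [set _ | _] = ~` [set x | g x <= f x]).
  by apply: measurableC; exact: measurable_set_le.
by apply/seteqP; split => x /=; [rewrite ltNge => /negP|move/negP; rewrite -ltNge].
Qed.

Section FiniteMeasure.
Context d (T : measurableType d) (R : realType).
Variable m : {finite_measure set T -> \bar R}.
Implicit Types f g : T -> R.

Lemma bounded_integrable f (c : R) : measurable_fun setT f ->
  (forall x, `|f x| <= c) -> m.-integrable setT (EFin \o f).
Proof.
move=> mf fc; apply: measurable_bounded_integrable => //.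
  by rewrite ltey_eq fin_num_measure.
by exists c; split; [exact: num_real|move=> M cM x _ /=; exact: le_trans (fc x) (ltW cM)].
Qed.

Lemma integrable_cst (c : R) : m.-integrable setT (EFin \o cst c).
Proof. exact: finite_measure_integrable_cst. Qed.

Lemma Rintegral_dominated (f_ : nat -> T -> R) f g :
  (forall k, measurable_fun setT (f_ k)) -> m.-integrable setT (EFin \o g) ->
  (forall k x, `|f_ k x| <= g x) -> (forall x, f_ ^~ x @ \oo --> f x) ->
  \int[m]_x f_ k x @[k --> \oo] --> \int[m]_x f x.
Proof.
move=> mf_ ig f_g f_f.
have mf : measurable_fun setT f by apply: (measurable_fun_cvg mf_) => x _; exact: f_f.
have cf x : setT x -> EFin (f_ k x) @[k --> \oo] --> EFin (f x).
  by move=> _; apply: cvg_EFin; [exact: nearW|exact: f_f].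
have [fi _ h] := @dominated_convergence _ _ _ m setT measurableT
  (fun k => EFin \o f_ k) (EFin \o f) (EFin \o g)
  (fun k => proj2 (measurable_EFinP _ _) (mf_ k)) (proj2 (measurable_EFinP _ _) mf)
  (aeW _ cf) ig (aeW _ (fun x k _ => f_g k x)).
apply: (fine_cvg (a := \int[m]_x f x)).
rewrite fineK//; exact: integrable_fin_num.
Qed.

Lemma Rintegral_bounded_cvg (f_ : nat -> T -> R) f (c : R) :
  (forall k, measurable_fun setT (f_ k)) ->
  (forall k x, `|f_ k x| <= c) -> (forall x, f_ ^~ x @ \oo --> f x) ->
  \int[m]_x f_ k x @[k --> \oo] --> \int[m]_x f x.
Proof.
by move=> mf fc; exact: (@Rintegral_dominated f_ f (cst c) mf (integrable_cst c) fc).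
Qed.

Lemma Rintegral_clamp_cvg f : m.-integrable setT (EFin \o f) ->
  \int[m]_x `|f x - clamp k%:R (f x)| @[k --> \oo] --> (0 : R).
Proof.
move=> fi.
have mf : measurable_fun setT f by apply/measurable_EFinP; exact: (measurable_int m).
have : \int[m]_x `|f x - clamp k%:R (f x)| @[k --> \oo] --> \int[m]_x (cst 0 x : R).
  apply: (@Rintegral_dominated _ _ (fun x => `|f x|)).
  - move=> k; apply: measurableT_comp => //; apply: measurable_funB => //.
    exact: measurable_clamp.
  - exact: integrable_norm.
  - by move=> k x; rewrite normr_id clamp_dist.
  - move=> x; rewrite /cst -[X in _ --> X](@normr0 _ R) -(subrr (f x)).
    by apply: cvg_norm; apply: cvgB; [exact: cvg_cst|exact: cvg_clamp].
by rewrite [X in _ --> X](_ : _ = 0)// Rintegral_cst// mul0r.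
Qed.

Lemma Rintegral_indic (A : set T) : measurable A -> \int[m]_x \1_A x = fine (m A).
Proof. by move=> mA; rewrite /Rintegral integral_indic// setIT. Qed.

Lemma Rintegral_markov f (c : R) : 0 < c -> m.-integrable setT (EFin \o f) ->
  c * fine (m [set x | c <= `|f x|]) <= \int[m]_x `|f x|.
Proof.
move=> c0 fi.
have mf : measurable_fun setT f by apply/measurable_EFinP; exact: (measurable_int m).
have mA : measurable [set x | c <= `|f x|].
  by apply: measurable_set_le => //; exact: measurableT_comp.
rewrite -Rintegral_indic// -RintegralZl//; last exact: integrable_indic.
apply: le_Rintegral => //.
- by apply: (integrableZl measurableT c (integrable_indic m mA)).
- exact: integrable_norm.
move=> x _; rewrite indicE; have [/set_mem/=|] := boolP (x \in _); rewrite ?mulr1//.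
by rewrite mulr0.
Qed.

Lemma pintegrable f (p C : R) : 1 < p -> measurable_fun setT f ->
  (\int[m]_x (`|f x| `^ p)%:E <= C%:E)%E ->
  [/\ m.-integrable setT (EFin \o f),
      m.-integrable setT (EFin \o (fun x => `|f x| `^ p)) &
      \int[m]_x (`|f x| `^ p) <= C].
Proof.
move=> p1 mf fC.
have mfp : measurable_fun setT (fun x => `|f x| `^ p).
  by apply: (measurableT_comp (measurable_powR p)); exact: measurableT_comp.
have ip : m.-integrable setT (EFin \o (fun x => `|f x| `^ p)).
  apply/integrableP; split; first exact/measurable_EFinP.
  under eq_integral do rewrite /= ger0_norm ?powR_ge0//.
  by rewrite (le_lt_trans fC)// ltry.
split => //.
  apply: (le_integrable measurableT _ _ (integrableD measurableT (integrable_cst 1) ip)).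
    exact/measurable_EFinP.
  move=> x _ /=; rewrite lee_fin [leRHS]ger0_norm ?addr_ge0 ?powR_ge0//.
  exact: le1D_powR.
by rewrite -lee_fin fineK//; exact: integrable_fin_num.
Qed.

End FiniteMeasure.

Section Density.
Context {R : realType} {n : nat}.
Local Notation V := 'rV[R]_n.
Local Notation B := (Bn R n).

(** Test functions live on the whole space; those of [weak_limit], continuous on [closure D] only,
    are reduced to them by [bcont_extension]. *)
Definition bcont (h : V -> R) := continuous h /\ exists c : R, forall x, `|h x| <= c.

Lemma bcont_measurable h : bcont h -> measurable_fun setT (h : B -> R).
Proof. by case=> /continuous_measurable. Qed.

Lemma bcont_lin (a : R) f g : bcont f -> bcont g -> bcont (fun x => a * f x + g x).
Proof.
move=> [cf [b fb]] [cg [c gc]]; split.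
  by apply: ctsD => //; apply: ctsM => //; exact: cts_cst.
exists (`|a| * b + c) => x; rewrite (le_trans (ler_normD _ _))// lerD// normrM.
by rewrite ler_wpM2l.
Qed.

Lemma bcont_bumps s k : bcont (rbumps s k).
Proof.
split; first exact: continuous_bumps.
by exists 1 => x; have /andP[? ?] := bumps_itv (map ratpair s) k x; rewrite ger0_norm.
Qed.

Variable m : {finite_measure set B -> \bar R}.

Lemma bcont_integrable h : bcont h -> m.-integrable setT (EFin \o (h : B -> R)).
Proof.
by move=> [ch [c hc]]; exact: (@bounded_integrable _ B R m h c (continuous_measurable ch) hc).
Qed.

Lemma integrable_bcont_mul h f : bcont h ->
  m.-integrable setT (EFin \o (f : B -> R)) ->
  m.-integrable setT (EFin \o (fun x : B => h x * f x)).
Proof.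
move=> bh fi; have [_ [c hc]] := bh.
apply: (integrableMr (mu := m) measurableT (bcont_measurable bh) _ fi).
exists c; split; first exact: num_real.
by move=> M cM x _ /=; apply: le_trans (hc x) (ltW cM).
Qed.

(** Measurability and a bound belong to the predicate so that every stage of the monotone class
    induction can integrate. *)
Let approximable (f : V -> R) := [/\ measurable_fun setT (f : B -> R),
  exists c : R, forall x, `|f x| <= c &
  forall e : R, 0 < e -> exists2 g, bcont g & \int[m]_x `|(f x - g x)| <= e].

Let dist_integrable (f g : V -> R) :
  m.-integrable setT (EFin \o (f : B -> R)) -> bcont g ->
  m.-integrable setT (EFin \o (fun x : B => `|f x - g x|)).
Proof.
move=> fi bg; apply: (integrable_norm (f := fun x : B => f x - g x)).
exact: (integrableB measurableT fi (bcont_integrable bg)).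
Qed.

Lemma bcont_dense_bounded (f : V -> R) (c : R) : measurable_fun setT (f : B -> R) ->
  (forall x, `|f x| <= c) ->
  forall e, 0 < e -> exists2 g, bcont g & \int[m]_x `|(f x - g x)| <= e.
Proof.
move=> mf fc; suff [] : approximable f by [].
apply: functional_monotone_class mf fc.
- move=> a f1 f2 [mf1 [c1 fc1] d1] [mf2 [c2 fc2] d2].
  have i1 := @bounded_integrable _ B R m f1 c1 mf1 fc1.
  have i2 := @bounded_integrable _ B R m f2 c2 mf2 fc2.
  have bb x : `|a * f1 x + f2 x| <= `|a| * c1 + c2.
    by rewrite (le_trans (ler_normD _ _))// lerD// normrM ler_wpM2l.
  have m12 : measurable_fun setT (fun x : B => a * f1 x + f2 x).
    by apply: measurable_funD => //; apply: measurable_funM => //; exact: measurable_cst.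
  split => //; first by exists (`|a| * c1 + c2).
  move=> e e0.
  have a1 : 0 < `|a| + 1 by rewrite ltr_wpDl.
  have [g1 b1 h1] := d1 (e / (2 * (`|a| + 1))) (divr_gt0 e0 (mulr_gt0 (ltr0Sn R 1) a1)).
  have [g2 b2 h2] := d2 (e / 2) (divr_gt0 e0 (ltr0Sn R 1)).
  exists (fun x => a * g1 x + g2 x); first exact: bcont_lin.
  have j1 := dist_integrable i1 b1; have j2 := dist_integrable i2 b2.
  apply: (@le_trans _ _ (`|a| * \int[m]_x `|f1 x - g1 x| + \int[m]_x `|f2 x - g2 x|)).
    have j1' := integrableZl measurableT `|a| j1.
    rewrite -RintegralZl// -RintegralD//.
    apply: le_Rintegral => //.
    + apply: dist_integrable; [exact: (@bounded_integrable _ B R m _ _ m12 bb)|exact: bcont_lin].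
    + exact: (integrableD measurableT j1' j2).
    move=> x _; rewrite -normrM; apply: le_trans (ler_normD _ _).
    by rewrite mulrBr opprD addrACA.
  have : `|a| * \int[m]_x `|f1 x - g1 x| <= e / 2.
    apply: le_trans (ler_wpM2l (normr_ge0 a) h1) _.
    rewrite invfM mulrA mulrA [X in X <= _](_ : _ = e / 2 * (`|a| / (`|a| + 1))); last by ring.
    by rewrite ler_piMr ?divr_ge0 1?ltW// ltr_pdivrMr// mul1r ltrDl.
  lra.
- move=> s k; have := bcont_bumps s k => bs; split.
  + exact: bcont_measurable.
  + by case: bs.
  + move=> e e0; exists (rbumps s k) => //.
    under eq_Rintegral do rewrite subrr normr0.
    by rewrite Rintegral_cst// mul0r ltW.
- move=> f_ g c' Ef f_c f_g.
  have gc x : `|g x| <= c'.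
    have cn := cvg_norm (f_g x).
    apply: (@cvgr_to_le _ \oo _ R (fun k => `|f_ k x|) `|g x| c'); first exact: cn.
    by apply: nearW => k; exact: f_c.
  have mf_ k : measurable_fun setT (f_ k : B -> R) by case: (Ef k).
  have mg : measurable_fun setT (g : B -> R).
    by apply: (@measurable_fun_cvg _ B R setT f_) => // x _; exact: f_g.
  split => //; first by exists c'.
  move=> e e0.
  have i_ k := @bounded_integrable _ B R m _ _ (mf_ k) (f_c k).
  have ig := @bounded_integrable _ B R m _ _ mg gc.
  have : \int[m]_x `|g x - f_ k x| @[k --> \oo] --> \int[m]_x (cst 0 x : R).
    apply: (@Rintegral_bounded_cvg _ B R m _ _ (c' + c')).
    + move=> k; apply: measurableT_comp => //; exact: measurable_funB.
    + by move=> k x; rewrite normr_id (le_trans (ler_normB _ _))// lerD.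
    + move=> x; rewrite /cst -[X in _ --> X](@normr0 _ R) -(subrr (g x)).
      by apply: cvg_norm; apply: cvgB => //; exact: cvg_cst.
  rewrite [X in _ --> X](_ : _ = 0); last by rewrite Rintegral_cst// mul0r.
  move=> /cvgrPdist_le/(_ (e / 2) (divr_gt0 e0 (ltr0Sn R 1)))[k _ /(_ k (leqnn k))].
  rewrite sub0r normrN ger0_norm; last by apply: Rintegral_ge0 => x _.
  move=> hk; have [_ _ /(_ (e / 2) (divr_gt0 e0 (ltr0Sn R 1)))[h bh fh]] := Ef k.
  exists h => //.
  have j1 : m.-integrable setT (EFin \o (fun x : B => `|g x - f_ k x|)).
    exact: (integrable_norm (integrableB measurableT ig (i_ k))).
  have j2 := dist_integrable (i_ k) bh.
  apply: (@le_trans _ _ (\int[m]_x `|g x - f_ k x| + \int[m]_x `|f_ k x - h x|)).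
    rewrite -RintegralD//; apply: le_Rintegral => //.
    + exact: dist_integrable.
    + exact: (integrableD measurableT j1 j2).
    by move=> x _; exact: ler_distD.
  lra.
Qed.

(** Half of the error goes to truncation at some level [k], half to approximating the truncated
    function. *)
Lemma bcont_dense (f : V -> R) : m.-integrable setT (EFin \o (f : B -> R)) ->
  forall e, 0 < e -> exists2 g, bcont g & \int[m]_x `|(f x - g x)| <= e.
Proof.
move=> fi e e0.
have mf : measurable_fun setT (f : B -> R) by apply/measurable_EFinP; exact: (measurable_int m).
have mc k := measurable_clamp (k%:R : R) mf.
have bc k x : `|clamp k%:R (f x)| <= k%:R by exact: clamp_norm.
have := Rintegral_clamp_cvg fi.
move=> /cvgrPdist_le/(_ (e / 2) (divr_gt0 e0 (ltr0Sn R 1)))[k _ /(_ k (leqnn k))].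
rewrite sub0r normrN ger0_norm; last by apply: Rintegral_ge0 => x _.
move=> hk; have [h bh fh] := bcont_dense_bounded (mc k) (bc k) (divr_gt0 e0 (ltr0Sn R 1)).
have ic := @bounded_integrable _ B R m _ _ (mc k) (bc k).
exists h => //.
have j1 : m.-integrable setT (EFin \o (fun x : B => `|f x - clamp k%:R (f x)|)).
  exact: (integrable_norm (integrableB measurableT fi ic)).
have j2 := dist_integrable ic bh.
apply: (@le_trans _ _ (\int[m]_x `|f x - clamp k%:R (f x)| + \int[m]_x `|clamp k%:R (f x) - h x|)).
  rewrite -RintegralD//; apply: le_Rintegral => //.
  - exact: dist_integrable.
  - exact: (integrableD measurableT j1 j2).
  by move=> x _; exact: ler_distD.
lra.
Qed.

End Density.

(** * Weak convergence of measures and strong limit values *)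



Section FineMeasure.
Context d (T : measurableType d) (R : realType).
Variable m : {finite_measure set T -> \bar R}.
Implicit Types A C : set T.

Lemma fine_measure_ge0 A : 0 <= fine (m A).
Proof. by rewrite fine_ge0. Qed.

Lemma fine_measure_le A C : measurable A -> measurable C -> A `<=` C ->
  fine (m A) <= fine (m C).
Proof.
move=> mA mC AC; rewrite fine_le ?fin_num_measure//.
by apply: le_measure => //; rewrite inE.
Qed.

Lemma fine_measureU_le A C : measurable A -> measurable C ->
  fine (m (A `|` C)) <= fine (m A) + fine (m C).
Proof.
move=> mA mC; rewrite -fineD ?fin_num_measure// fine_le ?fin_numD ?fin_num_measure//.
  exact: measurableU.
exact: measureU2.
Qed.

Lemma fine_measure_bigcup_le (F : nat -> set T) k : (forall i, measurable (F i)) ->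
  fine (m (\bigcup_(i in `I_k) F i)) <= \sum_(i < k) fine (m (F i)).
Proof.
move=> mF; rewrite bigcup_mkord.
elim: k => [|k IH]; first by rewrite !big_ord0 measure0.
rewrite !big_ord_recr/= (le_trans (fine_measureU_le _ _))// ?lerD//.
by apply: bigsetU_measurable.
Qed.

End FineMeasure.

Section WeakConvergence.
Context {R : realType} {n : nat}.
Local Notation V := 'rV[R]_n.
Local Notation B := (Bn R n).
Variables (m : nat -> {finite_measure set B -> \bar R}) (m0 : {finite_measure set B -> \bar R}).

Definition weakly_cvg := forall h : V -> R, bcont h ->
  \int[m j]_x h x @[j --> \oo] --> \int[m0]_x h x.

Hypothesis wm : weakly_cvg.

Lemma weakly_cvg_mass : fine (m j setT) @[j --> \oo] --> fine (m0 setT).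
Proof.
have b1 : bcont (fun _ : V => 1 : R).
  by split; [exact: cts_cst|exists 1 => x; rewrite normr1].
have := wm b1; rewrite Rintegral_cst// mul1r.
by under eq_fun do rewrite Rintegral_cst// mul1r.
Qed.

(** Write [U] as the union of the rational balls [F i] with [i] in [P]. The product [f k] of 1 -
    bump over those with [i < k] is a continuous majorant of the indicator of the complement of [U]
    and tends to it pointwise; for fixed [k], its mean against [m j] passes to the limit. *)
Lemma portmanteau_closed (U : set V) (e : R) : open U -> 0 < e ->
  \forall j \near \oo, fine (m j (~` U)) <= fine (m0 (~` U)) + e.
Proof.
move=> oU e0.
have mU : measurable (~` U : set B) by apply: measurableC; exact: open_measurable_Bn.
have [F [P UE]] := open_rat_bigcup oU.
pose g i k (x : V) : R := if i \in P then 1 - ball_bump (ratmx (F i).1) (ratr (F i).2) k x else 1.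
pose f k (x : V) : R := \prod_(i < k) g i k x.
have fI k x : 0 <= f k x <= 1.
  rewrite /f; elim/big_ind: _ => [|a b /andP[a0 a1] /andP[b0 b1]|i _].
  - by rewrite ler01 lexx.
  - by rewrite mulr_ge0// mulr_ile1.
  - rewrite /g; case: ifP => _; rewrite ?ler01 ?lexx// subr_ge0 ball_bump_le1/=.
    by rewrite gerBl ball_bump_ge0.
have cg i k : continuous (g i k).
  have [iP|iP] := boolP (i \in P); last first.
    by rewrite (_ : g i k = (fun=> 1)) /g ?(negbTE iP)//; exact: cts_cst.
  rewrite (_ : g i k = (fun x => 1 - ball_bump (ratmx (F i).1) (ratr (F i).2) k x)) /g ?iP//.
  by apply: ctsB; [exact: cts_cst|exact: continuous_ball_bump].
have cf k : continuous (f k).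
  rewrite /f; elim: (index_enum _) => [|i s IH].
    rewrite (_ : (fun x : V => _) = (fun=> 1)); first exact: cts_cst.
    by apply/funext => x; rewrite big_nil.
  rewrite (_ : (fun x : V => _) = (fun x => g i k x * \prod_(j <- s) g j k x)).
    by apply: ctsM.
  by apply/funext => x; rewrite big_cons.
have bf k : bcont (f k).
  by split => //; exists 1 => x; have /andP[? ?] := fI k x; rewrite ger0_norm.
have f1 k x : \1_(~` U) x <= f k x.
  rewrite indicE; have [/set_mem xU|_] := boolP (x \in _); last by have /andP[] := fI k x.
  rewrite /f big1// => i _; rewrite /g; case: ifPn => [/set_mem Pi|//].
  rewrite ball_bump_out ?subr0// => xi; apply: xU; rewrite UE; exists i => //.
have : \int[m0]_x f k x @[k --> \oo] --> \int[m0]_x (\1_(~` U) x : R).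
  apply: (@Rintegral_bounded_cvg _ B R m0 _ _ 1).
  - by move=> k; exact: bcont_measurable.
  - by move=> k x; have /andP[? ?] := fI k x; rewrite ger0_norm.
  move=> x; apply: cvg_near_cst.
  have [/set_mem xU|xU] := boolP (x \in ~` U).
    near=> k; apply/eqP; rewrite eq_le f1 andbT indicE mem_set//.
    by have /andP[] := fI k x.
  have /contrapT Ux : ~ ~ U x by move=> h; move: xU; rewrite mem_set.
  have [i Pi /= xi] : (\bigcup_(k in P) [set y | `|y - ratmx (F k).1| < ratr (F k).2]) x.
    by rewrite -UE.
  near=> k; rewrite indicE (negbTE xU).
  have ik : (i < k)%N by near: k; exact: nbhs_infty_gt.
  rewrite /f (bigD1 (Ordinal ik))//= /g mem_set// (_ : ball_bump _ _ _ _ = 1) ?subrr ?mul0r//.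
  near: k; exact: ball_bump_in.
rewrite Rintegral_indic// => /cvgrPdist_le/(_ (e / 2) (divr_gt0 e0 (ltr0Sn R 1))).
move=> [k _ /(_ k (leqnn k)) hk].
have /cvgrPdist_le/(_ (e / 2) (divr_gt0 e0 (ltr0Sn R 1))) := wm (bf k).
apply: filterS => j; rewrite ler_norml => /andP[hj _].
move: hk; rewrite ler_norml => /andP[hk _].
have : fine (m j (~` U)) <= \int[m j]_x f k x.
  rewrite -Rintegral_indic//; apply: le_Rintegral => //.
  - exact: integrable_indic.
  - exact: bcont_integrable.
lra.
Unshelve. all: by end_near. Qed.

Section StrongLimit.
Variables (w psi : V -> R).
Hypotheses (mw : measurable_fun setT (w : B -> R))
  (ipsi : m0.-integrable setT (EFin \o (psi : B -> R))).
(** Unlike in [strong_limit], [U] covers the level set up to a null set: the strong limit values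
    along a sequence agree with [psi] only almost everywhere. *)
Hypothesis wpsi : forall a b eps delta : R, a < b -> 0 < eps -> 0 < delta ->
  exists j0 : nat, exists U : set V, [/\ open U,
    m0 ([set x | a <= psi x < b] `\` U) = 0%E &
    forall j, (j0 <= j)%N ->
      (m j (U `&` [set x | (w x < a - eps)%R]) +
       m j (U `&` [set x | (b + eps < w x)%R]) < delta%:E)%E].

Let mpsi : measurable_fun setT (psi : B -> R).
Proof. by apply/measurable_EFinP; exact: (measurable_int m0). Qed.

Lemma measurable_dist_ge (f g : V -> R) (c : R) :
  measurable_fun setT (f : B -> R) -> measurable_fun setT (g : B -> R) ->
  measurable ([set x | c <= `|f x - g x|] : set B).
Proof.
move=> mf mg; apply: measurable_set_le => //.
by apply: measurableT_comp => //; exact: measurable_funB.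
Qed.

(* Cut the range of [psi] into intervals of length [eta]: on the open set [U'] where, for some
   interval, [w] is near it and [g] is near its left end, [w] is within [4 * eta] of [g] up to
   small measure, and the portmanteau inequality controls the mass outside [U']. *)
Lemma strong_limit_near_measure (eta delta : R) : 0 < eta -> 0 < delta ->
  exists g, [/\ bcont g, \int[m0]_x `|psi x - g x| <= eta * delta &
    \forall j \near \oo, fine (m j [set x | 4 * eta <= `|w x - g x|]) <= delta].
Proof.
move=> eta0 delta0.
have d4 : 0 < delta / 4 by rewrite divr_gt0.
(* With L^1 distance [eta * (delta / 4)], Markov bounds the mass of [eta <= |psi - g|] by
   [delta / 4]. *)
have [g bg gE] := bcont_dense ipsi (mulr_gt0 eta0 d4).
exists g; split => //; first by rewrite (le_trans gE)// ler_pM2l//; lra.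
have mg := bcont_measurable bg.
have i1 := integrableB measurableT ipsi (bcont_integrable m0 bg).
have h1 : fine (m0 [set x | eta <= `|psi x - g x|]) <= delta / 4.
  rewrite -(ler_pM2l eta0); apply: le_trans gE.
  exact: (@Rintegral_markov _ B R m0 (fun x => psi x - g x) eta eta0 i1).
(* By Markov again, [N <= |psi|] has mass at most [delta / 4]. The [K] intervals of length [eta]
   starting at [- N] then reach beyond [N]. *)
pose N : R := 4 * (\int[m0]_x `|psi x| + 1) / delta.
have I0 : 0 <= \int[m0]_x `|psi x| by apply: Rintegral_ge0.
have N0 : 0 < N by rewrite divr_gt0// mulr_gt0// ltr_wpDl.
have h2 : fine (m0 [set x | N <= `|psi x|]) <= delta / 4.
  rewrite -(ler_pM2l N0); apply: (le_trans (@Rintegral_markov _ B R m0 psi N N0 ipsi)).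
  rewrite /N (_ : _ / delta * (delta / 4) = \int[m0]_x `|psi x| + 1).
    by rewrite lerDl.
  by field; rewrite gt_eqF.
pose K := (Num.truncn (2 * N / eta)).+1.
have KN : 2 * N < K%:R * eta by rewrite -ltr_pdivrMr//; exact: truncnS_gt.
pose a i : R := - N + i%:R * eta.
have K0 : 0 < (K%:R : R) by rewrite ltr0n.
have /choice[jU hjU] : forall i : nat, exists jU : nat * set V, [/\ open jU.2,
    m0 ([set x | a i <= psi x < a i + eta] `\` jU.2) = 0%E &
    forall j, (jU.1 <= j)%N ->
      (m j (jU.2 `&` [set x | (w x < a i - eta)%R]) +
       m j (jU.2 `&` [set x | (a i + eta + eta < w x)%R]) < (delta / 4 / K%:R)%:E)%E].
  move=> i; have aia : a i < a i + eta by rewrite ltrDl.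
  have [j0 [U hU]] := wpsi aia eta0 (divr_gt0 d4 K0).
  by exists (j0, U).
(* From [a i <= psi < a i + eta] and [|psi - g| < eta] follows [|g - a i| < 2 * eta]. Hence, up to
   the null sets [Z i], the complement of [U'] lies in the two Markov events. *)
pose U' := \bigcup_(i in `I_K) ((jU i).2 `&` [set x | `|g x - a i| < 2 * eta]).
have oU' : open U'.
  apply: bigcup_open => i _; have [oU _ _] := hjU i; apply: openI => //.
  have cga : continuous (fun x => `|g x - a i|).
    by apply: cts_norm; apply: ctsB; [case: bg|exact: cts_cst].
  exact: (open_comp (fun x _ => cga x) (@open_lt R (2 * eta))).
pose Z i := [set x | a i <= psi x < a i + eta] `\` (jU i).2 : set B.
have mZ i : measurable (Z i).
  apply: measurableD; last by apply: open_measurable_Bn; case: (hjU i).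
  rewrite (_ : [set _ | _] = [set x | a i <= psi x] `&` [set x | psi x < a i + eta]).
    apply: measurableI; [exact: measurable_set_le|exact: measurable_set_lt].
  by apply/seteqP; split => x /=; [move/andP|move=> [? ?]; apply/andP].
have mU'C : measurable (~` U' : set B).
  by apply: measurableC; exact: open_measurable_Bn.
have m1 := measurable_dist_ge eta mpsi mg.
have m2 : measurable ([set x | N <= `|psi x|] : set B).
  by apply: measurable_set_le => //; exact: measurableT_comp.
have mbZ : measurable (\bigcup_(i in `I_K) Z i) by apply: bigcup_measurable.
have h3 : fine (m0 (~` U')) <= delta / 2.
  have sub : ~` U' `<=` ([set x | eta <= `|psi x - g x|] `|` [set x | N <= `|psi x|])
      `|` \bigcup_(i in `I_K) Z i.
    move=> x xU'; apply: contrapT => /not_orP[/not_orP[/negP x1 /negP x2] x3].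
    rewrite -ltNge in x1; rewrite -ltNge in x2.
    move: x2; rewrite ltr_norml => /andP[x2 x2'].
    pose i := Num.truncn ((psi x + N) / eta).
    have t0 : 0 <= (psi x + N) / eta by rewrite divr_ge0 ?(ltW eta0)//; lra.
    have /andP[ti1 ti2] := truncn_itv t0.
    rewrite ler_pdivlMr// in ti1; rewrite ltr_pdivrMr// in ti2.
    have xa : a i <= psi x < a i + eta.
      by apply/andP; split; rewrite /a; move: ti2; rewrite -/i -natr1 mulrDl mul1r; lra.
    have iK : (i < K)%N.
      rewrite -(ltr_nat R) -(ltr_pM2r eta0); apply: le_lt_trans ti1 _; lra.
    have Ux : (jU i).2 x.
      by apply: contrapT => nU; apply: x3; exists i.
    apply: xU'; exists i => //; split => //=.
    rewrite ltr_norml; move: x1; rewrite ltr_norml => /andP[? ?].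
    by move: xa => /andP[? ?]; apply/andP; split; lra.
  apply: (le_trans (fine_measure_le m0 mU'C _ sub)).
    by apply: measurableU => //; exact: measurableU.
  apply: (le_trans (fine_measureU_le m0 (measurableU _ _ m1 m2) mbZ)).
  have := fine_measureU_le m0 m1 m2.
  have := fine_measure_bigcup_le m0 K mZ.
  rewrite big1; first by lra.
  by move=> i _; have [_ + _] := hjU i; rewrite /Z => ->.
(* On the i-th piece of [U'] outside [Bad i], [w] lies between [a i - eta] and [a i + 2 * eta] while
   [g] is within [2 * eta] of [a i]; hence the [4 * eta]. The masses add up to
   [delta / 2 + delta / 4] for the complement of [U'] and [delta / 4] for all bad sets together. *)
pose Bad i := ((jU i).2 `&` [set x | (w x < a i - eta)%R]) `|`
  ((jU i).2 `&` [set x | (a i + eta + eta < w x)%R]) : set B.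
have mwlt c : measurable ([set x | w x < c] : set B).
  exact: measurable_set_lt.
have mwgt c : measurable ([set x | c < w x] : set B).
  exact: measurable_set_lt.
have mUi i : measurable ((jU i).2 : set B).
  by apply: open_measurable_Bn; case: (hjU i).
have mBad i : measurable (Bad i).
  by apply: measurableU; apply: measurableI.
have mbBad : measurable (\bigcup_(i in `I_K) Bad i) by apply: bigcup_measurable.
near=> j.
have hU' : fine (m j (~` U')) <= fine (m0 (~` U')) + delta / 4.
  by near: j; exact: portmanteau_closed.
have hB i : (i < K)%N -> fine (m j (Bad i)) <= delta / 4 / K%:R.
  move=> iK; have [_ _ /(_ j) h] := hjU i.
  have /h{}h : ((jU i).1 <= j)%N.
    have : (\max_(i < K) (jU i).1 <= j)%N by near: j; exact: nbhs_infty_ge.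
    by apply: leq_trans; exact: (leq_bigmax (F := fun i : 'I_K => (jU i).1) (Ordinal iK)).
  apply: (le_trans (fine_measureU_le _ _ _)); try by apply: measurableI.
  rewrite -lee_fin EFinD !fineK ?fin_num_measure//; try by apply: measurableI.
  exact: ltW.
have sub : [set x | 4 * eta <= `|w x - g x|] `<=` ~` U' `|` \bigcup_(i in `I_K) Bad i.
  move=> x /= wg; have [xU'|] := pselect (U' x); last by left.
  right; case: xU' => i iK [Uix /= gx]; exists i => //.
  apply: contrapT => /not_orP[/not_andP[//|/negP w1] /not_andP[//|/negP w2]].
  move: wg; rewrite leNgt => /negP; apply.
  rewrite -leNgt in w1; rewrite -leNgt in w2.
  move: gx; rewrite !ltr_norml => /andP[? ?]; apply/andP; split; lra.
apply: (le_trans (fine_measure_le (m j) (measurable_dist_ge _ mw mg)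
  (measurableU _ _ mU'C mbBad) sub)).
apply: (le_trans (fine_measureU_le (m j) mU'C mbBad)).
have := fine_measure_bigcup_le (m j) K mBad.
have : \sum_(i < K) fine (m j (Bad i)) <= \sum_(i < K) (delta / 4 / K%:R).
  by apply: ler_sum => i _; exact: hB.
rewrite sumr_const card_ord -[_ *+ _]mulr_natr -mulrA mulVf ?gt_eqF// mulr1.
lra.
Unshelve. all: by end_near. Qed.

End StrongLimit.

End WeakConvergence.



Section StrongLimitMean.
Context {R : realType} {n : nat}.
Local Notation V := 'rV[R]_n.
Local Notation B := (Bn R n).
Variables (m : nat -> {finite_measure set B -> \bar R}) (m0 : {finite_measure set B -> \bar R}).
Hypothesis wm : weakly_cvg m m0.
Variables (w psi : V -> R) (p C : R).
Hypotheses (p1 : 1 < p) (mw : measurable_fun setT (w : B -> R))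
  (ipsi : m0.-integrable setT (EFin \o (psi : B -> R))).
Hypothesis wC : forall j, (\int[m j]_x (`|w x| `^ p)%:E <= C%:E)%E.
Hypothesis wpsi : forall a b eps delta : R, a < b -> 0 < eps -> 0 < delta ->
  exists j0 : nat, exists U : set V, [/\ open U,
    m0 ([set x | a <= psi x < b] `\` U) = 0%E &
    forall j, (j0 <= j)%N ->
      (m j (U `&` [set x | (w x < a - eps)%R]) +
       m j (U `&` [set x | (b + eps < w x)%R]) < delta%:E)%E].

(** Both means are compared with that of a clamped continuous [g]. Of the six parts [e / 6] of the
    error, two are for [psi] against [g], three for [w] against [g], one for the weak convergence on
    [g]. *)
Lemma strong_limit_mean : \int[m j]_x w x @[j --> \oo] --> \int[m0]_x psi x.
Proof.
have mpsi : measurable_fun setT (psi : B -> R).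
  by apply/measurable_EFinP; exact: (measurable_int m0).
have iw j : [/\ (m j).-integrable setT (EFin \o (w : B -> R)),
      (m j).-integrable setT (EFin \o (fun x : B => `|w x| `^ p)) &
      \int[m j]_x (`|w x| `^ p) <= C] by exact: pintegrable.
have C0 : 0 <= C.
  have [_ _] := iw 0%N; apply: le_trans; apply: Rintegral_ge0 => x _; exact: powR_ge0.
apply/cvgrPdist_le => e e0.
have e6 : 0 < e / 6 by rewrite divr_gt0.
have [N [N0 NC Npsi]] : exists N : R, [/\ 0 < N, (N `^ (p - 1))^-1 * C <= e / 6 &
    \int[m0]_x `|psi x - clamp N (psi x)| <= e / 6].
  move/cvgrPdist_le/(_ _ e6) : (Rintegral_clamp_cvg ipsi) => [k0 _ hk0].
  have p10 : 0 < p - 1 by rewrite subr_gt0.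
  (* The level at which [(C + 1) / M^(p - 1)] equals [e / 6]. *)
  pose M := (6 * (C + 1) / e) `^ (p - 1)^-1.
  pose k := maxn k0 (Num.truncn M).+1.
  have Mk : M <= k%:R.
    apply: (le_trans (ltW (truncnS_gt M))); rewrite ler_nat; exact: leq_maxr.
  have D0 : 0 < 6 * (C + 1) / e by rewrite divr_gt0// mulr_gt0// ltr_wpDl.
  have M0 : 0 < M by rewrite powR_gt0.
  exists k%:R; split.
  - exact: lt_le_trans Mk.
  - rewrite mulrC ler_pdivrMr ?powR_gt0 ?(lt_le_trans M0)//.
    have : M `^ (p - 1) <= k%:R `^ (p - 1).
      by rewrite ge0_ler_powR ?nnegrE// ltW.
    rewrite /M -powRrM mulVf ?gt_eqF// powRr1 ?(ltW D0)// => h.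
    rewrite mulrC -ler_pdivrMr//; apply: le_trans h.
    rewrite invf_div mulrA [C * 6]mulrC ler_pM2r ?invr_gt0//; lra.
  - have := hk0 k (leq_maxl _ _).
    by rewrite sub0r normrN ger0_norm// Rintegral_ge0.
pose M := fine (m0 setT) + 1.
have M0 : 0 < M by rewrite ltr_wpDl// fine_measure_ge0.
(* [M] bounds the masses of [m j] for large [j]. The choices give [4 * eta * M = e / 12],
   [2 * N * delta <= e / 12] and [eta * delta <= e / 6]. *)
pose eta := e / 6 / (8 * M).
have eta0 : 0 < eta by rewrite divr_gt0// mulr_gt0.
pose delta := Num.min (e / 6 / (4 * N)) (e / 6 / eta).
have delta0 : 0 < delta by rewrite lt_min !divr_gt0// mulr_gt0.
have [g' [bg' g'psi g'w]] := strong_limit_near_measure wm mw ipsi wpsi eta0 delta0.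
(* On the exceptional set, the clamped [w] and the clamped [g'] differ by at most [2 * N]; elsewhere
   clamping costs nothing, being 1-Lipschitz. *)
pose g x := clamp N (g' x).
have bg : bcont g.
  split; first by apply: cts_clamp; case: bg'.
  by exists N => x; apply: clamp_norm; exact: ltW.
have mg := bcont_measurable bg.
have mg' := bcont_measurable bg'.
have mcp := measurable_clamp N mpsi.
have icp : m0.-integrable setT (EFin \o (fun x : B => clamp N (psi x))).
  by apply: (@bounded_integrable _ B R m0 _ N mcp) => x; apply: clamp_norm; exact: ltW.
have h0 : `|\int[m0]_x psi x - \int[m0]_x g x| <= e / 6 + e / 6.
  rewrite -RintegralB//; last exact: bcont_integrable.
  have ipg := integrableB measurableT ipsi (bcont_integrable m0 bg).
  apply: (le_trans (le_normr_Rintegral (mu := m0) measurableT ipg)).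
  have j1 : m0.-integrable setT (EFin \o (fun x : B => `|psi x - clamp N (psi x)|)).
    exact: (integrable_norm (integrableB measurableT ipsi icp)).
  have j2 : m0.-integrable setT (EFin \o (fun x : B => `|psi x - g' x|)).
    exact: (integrable_norm (integrableB measurableT ipsi (bcont_integrable m0 bg'))).
  apply: (@le_trans _ _ (\int[m0]_x `|psi x - clamp N (psi x)| + \int[m0]_x `|psi x - g' x|)).
    rewrite -RintegralD//; apply: le_Rintegral => //.
    - exact: (integrable_norm (integrableB measurableT ipsi (bcont_integrable m0 bg))).
    - exact: (integrableD measurableT j1 j2).
    move=> x _; apply: le_trans (ler_distD (clamp N (psi x)) _ _) _.
    by rewrite lerD2l; apply: clamp_lip; exact: ltW.
  apply: lerD => //; apply: (le_trans g'psi).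
  by rewrite mulrC -ler_pdivlMr// ge_min lexx orbT.
have /cvgrPdist_le/(_ _ e6) := wm bg.
have /cvgrPdist_le/(_ _ ltr01) := weakly_cvg_mass wm.
apply: filterS3 g'w => j hw hM hg.
have hj : `|\int[m j]_x w x - \int[m j]_x g x| <= e / 6 + (e / 6 + e / 6).
  have [i1 i2 i3] := iw j.
  have ig := bcont_integrable (m j) bg.
  rewrite -RintegralB//.
  have iwg := integrableB measurableT i1 ig.
  apply: (le_trans (le_normr_Rintegral (mu := m j) measurableT iwg)).
  pose A := [set x | 4 * eta <= `|w x - g' x|].
  have mA : measurable (A : set B) by exact: measurable_dist_ge.
  pose c := (N `^ (p - 1))^-1.
  have k1 := integrableZl measurableT c i2.
  have k2 := integrable_cst (m j) (4 * eta).
  have k3 := integrableZl measurableT (2 * N) (integrable_indic (m j) mA).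
  have k23 := integrableD measurableT k2 k3.
  have k123 := integrableD measurableT k1 k23.
  apply: (@le_trans _ _ (\int[m j]_x (c * `|w x| `^ p + (4 * eta + 2 * N * \1_A x)))).
    apply: le_Rintegral => //.
    - exact: (integrable_norm iwg).
    move=> x _; apply: le_trans (ler_distD (clamp N (w x)) _ _) _.
    apply: lerD; first exact: clamp_dist_powR.
    rewrite indicE; have [_|/negP xA] := boolP (x \in A).
      rewrite mulr1; apply: (le_trans (ler_normB _ _)).
      have := clamp_norm (w x) (ltW N0); have := clamp_norm (g' x) (ltW N0).
      rewrite /g; move: (eta0); lra.
    rewrite mulr0 addr0; apply: (le_trans (clamp_lip _ _ (ltW N0))).
    by rewrite leNgt; apply/negP => h; apply: xA; apply/mem_set; exact: ltW.
  rewrite RintegralD// RintegralD// [X in X + _]RintegralZl//.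
  rewrite [X in _ + (_ + X)]RintegralZl//; last exact: integrable_indic.
  rewrite Rintegral_cst// Rintegral_indic//.
  apply: lerD.
    by apply: le_trans NC; rewrite ler_wpM2l ?invr_ge0 ?powR_ge0.
  apply: lerD.
    have : fine (m j setT) <= M by move: hM; rewrite ler_norml /M => /andP[? ?]; lra.
    move=> hm; apply: (@le_trans _ _ (4 * eta * M)).
      by rewrite ler_wpM2l// mulr_ge0// ltW.
    rewrite /eta [X in X <= _](_ : _ = e / 6 / 2); first by lra.
    by field; rewrite ?gt_eqF.
  apply: (le_trans (ler_wpM2l _ hw)); first by rewrite mulr_ge0// ltW.
  apply: (@le_trans _ _ (2 * N * (e / 6 / (4 * N)))).
    by rewrite ler_wpM2l ?mulr_ge0 ?(ltW N0)// ge_min lexx.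
  rewrite [X in X <= _](_ : _ = e / 6 / 2); first by lra.
  by field; rewrite ?gt_eqF.
move: h0 hj hg; rewrite !ler_norml => /andP[? ?] /andP[? ?] /andP[? ?].
by apply/andP; split; lra.
Qed.

End StrongLimitMean.

(** * Weak compactness in L^p *)



Section PowR.
Context {R : realType}.

(** Makes |g|^q a test function when [g] is one. The expression by exp and ln covers nonzero points;
    0 is treated directly. *)
Lemma continuous_norm_powR (q : R) : 0 < q -> continuous (fun x : R => `|x| `^ q).
Proof.
move=> q0 x; have [->|x0] := eqVneq x 0.
  apply/cvgrPdist_lt => e e0; rewrite normr0 powR0 ?gt_eqF//.
  near=> y; rewrite sub0r normrN ger0_norm ?powR_ge0//.
  have -> : e = (e `^ q^-1) `^ q by rewrite -powRrM mulVf ?gt_eqF// powRr1// ltW.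
  rewrite gt0_ltr_powR ?nnegrE ?powR_ge0//.
  rewrite -[X in `|X|]subr0 distrC.
  near: y; apply: cvgr_dist_lt; first exact: cvg_id.
  exact: powR_gt0.
have nx : 0 < `|x| by rewrite normr_gt0.
have cn : {for x, continuous (fun y : R => expR (q * ln `|y|))}.
  apply: (continuous_comp (f := fun y : R => q * ln `|y|)); last exact: continuous_expR.
  apply: cvgM; first exact: cvg_cst.
  apply: (continuous_comp (f := fun y : R => `|y|)); first exact: norm_continuous.
  exact: continuous_ln.
have ex : expR (q * ln `|x|) = `|x| `^ q by rewrite /powR gt_eqF.
rewrite /continuous_at -ex.
apply: cvg_trans cn; apply: near_eq_cvg.
near=> y; rewrite /powR gt_eqF// normr_gt0.
near: y; exact: (@cvgr_neq0 R R R (nbhs x) _ idfun x cvg_id x0).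
Unshelve. all: by end_near. Qed.

Lemma powR_normD (q x y : R) : 0 < q ->
  `|x + y| `^ q <= 2 `^ q * (`|x| `^ q + `|y| `^ q).
Proof.
move=> q0; wlog xy : x y / `|x| <= `|y|.
  move=> h; have [|/ltW] := leP `|x| `|y|; first exact: h.
  by move/h; rewrite addrC [X in 2 `^ q * X]addrC.
apply: (@le_trans _ _ ((2 * `|y|) `^ q)).
  rewrite ge0_ler_powR ?nnegrE ?(ltW q0) ?mulr_ge0//.
  by rewrite (le_trans (ler_normD _ _))//; lra.
by rewrite powRM// ler_wpM2l ?powR_ge0// lerDr powR_ge0.
Qed.

(** Young's inequality for [t * |y|] and [|x| / t], with the factors 1/p and 1/q bounded by 1. A
    small [t] makes the term in [y] negligible at the price of a large factor on the term in [x]. *)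
Lemma young_scaled (p q t x y : R) : 0 < p -> 0 < q -> p^-1 + q^-1 = 1 -> 0 < t ->
  `|x * y| <= (t^-1) `^ q * `|x| `^ q + t `^ p * `|y| `^ p.
Proof.
move=> p0 q0 pq t0; have ti : 0 < t^-1 by rewrite invr_gt0.
rewrite normrM.
have -> : `|x| * `|y| = (t * `|y|) * (t^-1 * `|x|) by field; rewrite gt_eqF.
apply: (le_trans (conjugate_powR _ _ p0 q0 pq)); rewrite ?mulr_ge0 ?(ltW t0) ?(ltW ti)//.
rewrite !powRM// ?(ltW t0) ?(ltW ti)// addrC.
have p1 : p^-1 <= 1 by rewrite -pq lerDl invr_ge0 ltW.
have q1 : q^-1 <= 1 by rewrite -pq lerDr invr_ge0 ltW.
by apply: lerD; rewrite ler_piMr// mulr_ge0 ?powR_ge0.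
Qed.

End PowR.

Section RadonNikodymReal.
Context d (T : measurableType d) (R : realType).
Variable m : {finite_measure set T -> \bar R}.
Variable nu : set T -> R.
Hypotheses (nu0 : nu set0 = 0)
  (nu_sigma : forall F : nat -> set T, (forall i, measurable (F i)) -> trivIset setT F ->
    measurable (\bigcup_i F i) ->
    \sum_(0 <= i < k) nu (F i) @[k --> \oo] --> nu (\bigcup_i F i))
  (nu_dom : forall A, measurable A -> m A = 0%E -> nu A = 0).

Let nuE (A : set T) : \bar R := (nu A)%:E.

Let nuE0 : nuE set0 = 0%E. Proof. by rewrite /nuE nu0. Qed.

Let nuE_fin A : measurable A -> nuE A \is a fin_num. Proof. by []. Qed.

Let nuE_sigma : semi_sigma_additive nuE.
Proof.
move=> F mF tF mUF; rewrite /nuE.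
under eq_fun do rewrite sumEFin.
by apply: cvg_EFin; [exact: nearW|exact: nu_sigma].
Qed.

HB.instance Definition _ := isCharge.Build _ _ _ nuE nuE0 nuE_fin nuE_sigma.

Lemma Radon_Nikodym_real : exists2 f : T -> R, m.-integrable setT (EFin \o f) &
  forall A, measurable A -> nu A = \int[m]_x (\1_A x * f x).
Proof.
have dom : nuE `<< m.
  apply/null_content_dominatesP => A mA mA0; rewrite /nuE nu_dom//.
pose g := Radon_Nikodym nuE m.
have gfin x : g x \is a fin_num by exact: Radon_Nikodym_fin_num.
have gE : EFin \o (fine \o g) = g by apply/funext => x /=; rewrite fineK.
exists (fine \o g); first by rewrite gE; exact: Radon_Nikodym_integrable.
move=> A mA; have := Radon_Nikodym_integral dom mA; rewrite -/g.
move=> /(congr1 fine); rewrite [LHS]/= => ->.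
rewrite -[in LHS]gE -[LHS]/(\int[m]_(x in A) (fine (g x))) Rintegral_mkcond.
apply: eq_Rintegral => x _; rewrite patchE indicE.
by case: ifPn; rewrite ?mul1r ?mul0r.
Qed.

End RadonNikodymReal.

Section Diagonal.
Context {R : realType}.

Lemma diagonal_subsequence (a : nat -> nat -> R) :
  (forall k, exists c, forall j, `|a k j| <= c) ->
  exists2 phi : nat -> nat, {homo phi : i j / (i < j)%N} &
    forall k, cvgn (fun j => a k (phi j)).
Proof.
move=> ab.
have /choice[tau htau] : forall ks : nat * (nat -> nat), exists f : nat -> nat,
    {homo f : i j / (i < j)%N} /\ cvgn (fun j => a ks.1 (ks.2 (f j))).
  move=> [k s]; have [c hc] := ab k.
  have [|f finc fc] := @bolzano_weierstrass R (fun j => a k (s j)).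
    exists c; split; first exact: num_real.
    by move=> M cM j _ /=; apply: le_trans (hc _) (ltW cM).
  exists f; split => // i j ij; have := finc j i; rewrite leEnat => h.
  by rewrite ltnNge h -ltnNge.
(* [sigma k.+1] refines [sigma k] so that row [k] converges along it. *)
pose sigma := fix sigma k : nat -> nat :=
  if k is k'.+1 then sigma k' \o tau (k', sigma k') else id.
have tau_inc ks : {homo tau ks : i j / (i < j)%N} by case: (htau ks).
have sigma_inc k : {homo sigma k : i j / (i < j)%N}.
  by elim: k => [|k IH] i j ij //=; apply: IH; exact: tau_inc.
have inc_ge (f : nat -> nat) : {homo f : i j / (i < j)%N} -> forall i, (i <= f i)%N.
  by move=> fi; elim=> // i IH; apply: (leq_ltn_trans IH); exact: fi.
have sigma_tail k l : (k <= l)%N -> exists2 rho : nat -> nat,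
    {homo rho : i j / (i < j)%N} & sigma l = sigma k \o rho.
  elim: l => [|l IH]; first by rewrite leqn0 => /eqP ->; exists id.
  rewrite leq_eqVlt => /predU1P[->|]; first by exists id.
  rewrite ltnS => /IH[rho rinc rE]; exists (rho \o tau (l, sigma l)).
    by move=> i j ij /=; apply: rinc; exact: tau_inc.
  by rewrite /= rE.
(* The index is [j.+1] since row [k] converges from [sigma k.+1] on: for [j >= k] the diagonal runs
   inside that subsequence. *)
exists (fun j => sigma j.+1 j).
  move=> i j ij; have [rho rinc ->] := @sigma_tail i.+1 j.+1 (ltnW ij).
  by apply: sigma_inc; apply: (leq_trans ij); exact: inc_ge.
move=> k; have [_ /cvg_ex[/= l hl]] := htau (k, sigma k).
apply/cvg_ex; exists l => /=; apply/cvgrPdist_le => e e0.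
move/cvgrPdist_le/(_ e e0) : hl => [j0 _ hj0].
near=> j.
have kj : (k < j.+1)%N by rewrite ltnS; near: j; exact: nbhs_infty_ge.
have [rho rinc rE] := @sigma_tail k.+1 j.+1 kj.
suff : `|l - a k (sigma k.+1 (rho j))| <= e.
  by rewrite -[sigma k.+1 (rho j)]/((sigma k.+1 \o rho) j) -rE.
apply: hj0 => /=.
apply: leq_trans (inc_ge _ rinc j); near: j; exact: nbhs_infty_ge.
Unshelve. all: by end_near. Qed.

End Diagonal.



(** * The limit functional and its density *)

Section WeakLimit.
Context {R : realType} {n : nat}.
Local Notation V := 'rV[R]_n.
Local Notation B := (Bn R n).
Variables (m : nat -> {finite_measure set B -> \bar R}) (m0 : {finite_measure set B -> \bar R}).
Hypothesis wm : weakly_cvg m m0.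
Variables (u : V -> R) (p C : R).
Hypotheses (p1 : 1 < p) (mu : measurable_fun setT (u : B -> R)).
Hypothesis uC : forall j, (\int[m j]_x (`|u x| `^ p)%:E <= C%:E)%E.

Let q := p / (p - 1).

Let p0 : 0 < p. Proof. by rewrite (lt_trans _ p1). Qed.

Let q1 : 1 < q.
Proof. by rewrite /q ltr_pdivlMr ?subr_gt0// mul1r gtrBl. Qed.

Let q0 : 0 < q. Proof. by rewrite (lt_trans _ q1). Qed.

Let pq : p^-1 + q^-1 = 1.
Proof. by rewrite /q; field; rewrite !gt_eqF ?subr_gt0. Qed.

Let iu j : [/\ (m j).-integrable setT (EFin \o (u : B -> R)),
  (m j).-integrable setT (EFin \o (fun x : B => `|u x| `^ p)) &
  \int[m j]_x (`|u x| `^ p) <= C].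
Proof. exact: pintegrable. Qed.

Definition mean_against j (g : V -> R) : R := \int[m j]_x (g x * u x).
Local Notation a := mean_against.

Let igu j g : bcont g -> (m j).-integrable setT (EFin \o (fun x : B => g x * u x)).
Proof.
by move=> bg; have [i1 _ _] := iu j; exact: integrable_bcont_mul.
Qed.

Lemma mean_against_lin j (c : R) f g : bcont f -> bcont g ->
  a j (fun x : V => c * f x + g x) = c * a j f + a j g.
Proof.
move=> bf bg; rewrite /a; under eq_Rintegral do rewrite mulrDl -mulrA.
rewrite RintegralD//; [|exact: (integrableZl measurableT c (igu j bf))|exact: igu].
by rewrite RintegralZl//; exact: igu.
Qed.

Let bcont_powR g : bcont g -> bcont (fun x : V => `|g x| `^ q).
Proof.
move=> [cg [c gc]]; split.
  move=> x; apply: (@continuous_comp _ _ _ g (fun y : R => `|y| `^ q)); first exact: cg.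
  exact: continuous_norm_powR.
exists (c `^ q) => x; rewrite ger0_norm ?powR_ge0//.
have c0 : 0 <= c by exact: le_trans (gc x).
by rewrite ge0_ler_powR ?nnegrE// ltW.
Qed.

Let mpow (f : V -> R) : measurable_fun setT (f : B -> R) ->
  measurable_fun setT (fun x : B => `|f x| `^ q).
Proof.
move=> mf; apply: (measurableT_comp (measurable_powR q)).
exact: measurableT_comp.
Qed.

Let ipow (f : V -> R) c : measurable_fun setT (f : B -> R) -> (forall x, `|f x| <= c) ->
  m0.-integrable setT (EFin \o (fun x : B => `|f x| `^ q)).
Proof.
move=> mf fc; apply: (@bounded_integrable _ B R m0 _ (c `^ q) (mpow mf)) => x.
rewrite ger0_norm ?powR_ge0//.
have c0 : 0 <= c by exact: le_trans (fc x).
by rewrite ge0_ler_powR ?nnegrE// ltW.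
Qed.

Lemma mean_against_le j g (t : R) : bcont g -> 0 < t ->
  `|a j g| <= t^-1 `^ q * \int[m j]_x (`|g x| `^ q) + t `^ p * C.
Proof.
move=> bg t0; have [i1 i2 i3] := iu j.
have ig := igu j bg.
have jg := bcont_integrable (m j) (bcont_powR bg).
have k1 := integrableZl measurableT (t^-1 `^ q) jg.
have k2 := integrableZl measurableT (t `^ p) i2.
apply: (le_trans (le_normr_Rintegral (mu := m j) measurableT ig)).
apply: (@le_trans _ _ (\int[m j]_x (t^-1 `^ q * `|g x| `^ q + t `^ p * `|u x| `^ p))).
  apply: le_Rintegral => //.
  - exact: integrable_norm.
  - exact: (integrableD measurableT k1 k2).
  by move=> x _; exact: young_scaled.
rewrite RintegralD// [X in X + _]RintegralZl// [X in _ + X]RintegralZl//.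
by rewrite lerD2l ler_wpM2l ?powR_ge0.
Qed.

Let C0 : 0 <= C.
Proof.
by have [_ _] := iu 0; apply: le_trans; apply: Rintegral_ge0 => x _; exact: powR_ge0.
Qed.

(* The value at [f] of the extension by L^q(m0)-continuity of the functional
   [g |-> lim_j \int g u dm_j]; restrictions of [f] to the supports of the [m j]
   play no role, since these may be disjoint from that of [m0]. *)
Definition mean_limit (f : V -> R) (l : R) := forall e : R, 0 < e ->
  exists g, [/\ bcont g, \int[m0]_x (`|f x - g x| `^ q) <= e &
    \forall j \near \oo, `|a j g - l| <= e].

Definition bmeas (f : V -> R) := measurable_fun setT (f : B -> R) /\
  exists c : R, forall x, `|f x| <= c.

Let bcont_bmeas g : bcont g -> bmeas g.
Proof. by move=> bg; split; [exact: bcont_measurable|case: bg]. Qed.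

Let bmeas_lin (c : R) f g : bmeas f -> bmeas g -> bmeas (fun x : V => c * f x + g x).
Proof.
move=> [mf [b fb]] [mg [d gd]]; split.
  by apply: measurable_funD => //; apply: measurable_funM => //; exact: measurable_cst.
exists (`|c| * b + d) => x; rewrite (le_trans (ler_normD _ _))// lerD// normrM.
by rewrite ler_wpM2l.
Qed.

Let bmeasB f g : bmeas f -> bmeas g -> bmeas (fun x : V => f x - g x).
Proof.
move=> bf bg; have := bmeas_lin (-1) bg bf.
by rewrite (_ : (fun x => _) = (fun x => f x - g x))//; apply/funext => x; rewrite mulN1r addrC.
Qed.

Let ibpow f : bmeas f -> m0.-integrable setT (EFin \o (fun x : B => `|f x| `^ q)).
Proof. by move=> [mf [c fc]]; exact: ipow mf fc. Qed.

Let int_powD f g h : bmeas f -> bmeas g -> bmeas h ->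
  (forall x, `|h x| <= `|f x| + `|g x|) ->
  \int[m0]_x (`|h x| `^ q) <=
  2 `^ q * (\int[m0]_x (`|f x| `^ q) + \int[m0]_x (`|g x| `^ q)).
Proof.
move=> bf bg bh hfg.
have i1 := ibpow bf; have i2 := ibpow bg; have i3 := ibpow bh.
have i12 := integrableD measurableT i1 i2.
rewrite -RintegralD// -RintegralZl//; apply: le_Rintegral => //.
  exact: (integrableZl measurableT (2 `^ q) i12).
move=> x _; have := powR_normD `|f x| `|g x| q0; rewrite !normr_id; apply: le_trans.
rewrite ge0_ler_powR ?nnegrE ?(ltW q0)//.
by rewrite [leRHS]ger0_norm ?addr_ge0.
Qed.

Let c2 := 2 `^ q.
Let c20 : 0 < c2. Proof. exact: powR_gt0. Qed.

(** Here the estimate passes from the [m j] to [m0]: |g|^q is a test function for the approximant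
    [g], so its integrals converge. The factor [c2] is the cost of replacing [g] by [f]. *)
Lemma mean_limit_bound f l (t : R) : bmeas f -> mean_limit f l -> 0 < t ->
  `|l| <= t^-1 `^ q * (c2 * \int[m0]_x (`|f x| `^ q)) + t `^ p * C.
Proof.
move=> bf fl t0; set s := t^-1 `^ q.
have s0 : 0 < s by rewrite powR_gt0// invr_gt0.
apply/ler_addgt0Pr => e e0.
(* The errors add up to [d * (1 + s * (c2 + 1))]: [d] from the value at [g], the rest from the
   integral of |g|^q. *)
pose d := e / (2 + s * (c2 + 1)).
have D0 : 0 < 2 + s * (c2 + 1) by rewrite addr_gt0// mulr_gt0// addr_gt0.
have d0 : 0 < d by rewrite divr_gt0.
have [g [bg fg hg]] := fl d d0.
have /cvgrPdist_le/(_ d d0) hq := wm (bcont_powR bg).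
have [j [h1 h2]] : exists j, `|a j g - l| <= d /\
    `|\int[m0]_x (`|g x| `^ q) - \int[m j]_x (`|g x| `^ q)| <= d.
  by have [j0 _ hj] := filterI hg hq; have := hj j0 (leqnn j0); exists j0.
have h3 := mean_against_le j bg t0.
have h4 : \int[m0]_x (`|g x| `^ q) <=
    c2 * (\int[m0]_x (`|f x| `^ q) + \int[m0]_x (`|f x - g x| `^ q)).
  have bfg := bmeasB bf (bcont_bmeas bg).
  apply: int_powD => //; first exact: bcont_bmeas.
  move=> x; rewrite -[X in `|X| <= _](subKr (f x)).
  exact: ler_normB.
have h5 : `|l| <= `|a j g| + d.
  rewrite -[X in `|X| <= _](subKr (a j g)) (le_trans (ler_normB _ _))// lerD2l.
  exact: h1.
have h6 : \int[m j]_x (`|g x| `^ q) <= c2 * \int[m0]_x (`|f x| `^ q) + (c2 + 1) * d.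
  move: h2; rewrite ler_norml => /andP[h2 _].
  have := ler_wpM2l (ltW c20) fg.
  move: h2 h4; rewrite mulrDr mulrDl mul1r.
  move: (\int[m0]_x (`|f x - g x| `^ q)) (\int[m0]_x (`|f x| `^ q))
    (\int[m0]_x (`|g x| `^ q)) (\int[m j]_x (`|g x| `^ q)) c2.
  by move=> *; lra.
have h7 : s * \int[m j]_x (`|g x| `^ q) <=
    s * (c2 * \int[m0]_x (`|f x| `^ q)) + s * (c2 + 1) * d.
  by rewrite -mulrA -mulrDr ler_pM2l.
have h8 : d * (2 + s * (c2 + 1)) = e by rewrite /d mulfVK// gt_eqF.
rewrite mulrDr [d * (s * _)]mulrC in h8.
move: h3 h5 h7 h8; rewrite -/s; clear h1 h2 h4 h6 fg.
move: (\int[m j]_x (`|g x| `^ q)) (\int[m0]_x (`|f x| `^ q)) (t `^ p * C) (`|a j g|) `|l|.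
by move=> *; lra.
Qed.

Lemma mean_limit_lin (c : R) f g lf lg : bmeas f -> bmeas g ->
  mean_limit f lf -> mean_limit g lg ->
  mean_limit (fun x : V => c * f x + g x) (c * lf + lg).
Proof.
move=> bf bg hf hg e e0.
pose K := c2 * (`|c| `^ q + 1) + (`|c| + 1).
have K1 : 0 < c2 * (`|c| `^ q + 1) by rewrite mulr_gt0// ltr_wpDl// powR_ge0.
have K2 : 0 < `|c| + 1 by rewrite ltr_wpDl.
have K0 : 0 < K by rewrite addr_gt0.
have d0 : 0 < e / K by rewrite divr_gt0.
have dK : K * (e / K) = e by rewrite mulrC mulfVK// gt_eqF.
have [f' [bf' ff' af']] := hf _ d0; have [g' [bg' gg' ag']] := hg _ d0.
exists (fun x : V => c * f' x + g' x); split; first exact: bcont_lin.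
- have bff := bmeasB bf (bcont_bmeas bf'); have bgg := bmeasB bg (bcont_bmeas bg').
  have b0 : bmeas (fun _ : V => 0).
    by apply: bcont_bmeas; split; [exact: cts_cst|exists 0 => x; rewrite normr0].
  have bcff := bmeas_lin c bff b0.
  have h := @int_powD _ _ (fun x => (c * f x + g x) - (c * f' x + g' x)) bcff bgg
    (bmeasB (bmeas_lin c bf bg) (bmeas_lin c (bcont_bmeas bf') (bcont_bmeas bg'))).
  apply: (le_trans (h _)).
    move=> x; rewrite addr0 (le_trans _ (ler_normD _ _))// (_ : _ - _ = c * (f x - f' x) + (g x - g' x))//.
    by ring.
  under eq_Rintegral do rewrite addr0 normrM powRM//.
  rewrite RintegralZl//; last exact: ibpow.
  have : `|c| `^ q * \int[m0]_x (`|f x - f' x| `^ q) <= `|c| `^ q * (e / K).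
    exact: (ler_wpM2l (powR_ge0 _ _) ff').
  move=> h1.
  apply: (@le_trans _ _ (c2 * ((`|c| `^ q + 1) * (e / K)))).
    by rewrite ler_pM2l// mulrDl mul1r lerD.
  by rewrite mulrA -[leRHS]dK ler_pM2r// /K lerDl ltW.
- apply: filterS2 af' ag' => j h1 h2; rewrite mean_against_lin//.
  rewrite (_ : _ - _ = c * (a j f' - lf) + (a j g' - lg)); last by ring.
  apply: (le_trans (ler_normD _ _)); rewrite normrM.
  apply: (@le_trans _ _ ((`|c| + 1) * (e / K))).
    by rewrite mulrDl mul1r lerD// ler_wpM2l.
  by rewrite -[leRHS]dK ler_pM2r// /K lerDr ltW.
Qed.

(** Choose [t] with [t^p = e / (C + 1)]; the summand 1 keeps the quotient meaningful when
    [C = 0]. *)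
Let le_powRC (x : R) : (forall t, 0 < t -> x <= t `^ p * C) -> x <= 0.
Proof.
move=> h; apply/ler_addgt0Pr => e e0; rewrite add0r.
have C1 : 0 < C + 1 by rewrite ltr_wpDl.
have eC : 0 < e / (C + 1) by rewrite divr_gt0.
have := h ((e / (C + 1)) `^ p^-1) (powR_gt0 _ eC).
rewrite -powRrM mulVf ?gt_eqF// powRr1 ?(ltW eC)// => /le_trans; apply.
by rewrite -mulrA ler_piMr ?(ltW e0)// mulrC ler_pdivrMr// mul1r lerDl.
Qed.

Let mean_limitB f g lf lg (t : R) : bmeas f -> bmeas g ->
  mean_limit f lf -> mean_limit g lg -> 0 < t ->
  `|lf - lg| <= t^-1 `^ q * (c2 * \int[m0]_x (`|f x - g x| `^ q)) + t `^ p * C.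
Proof.
move=> bf bg hf hg t0.
have := mean_limit_lin (-1) bg bf hg hf; rewrite mulN1r addrC.
rewrite (_ : (fun x : V => _) = (fun x => f x - g x)); last first.
  by apply/funext => x; rewrite mulN1r addrC.
by move=> h; apply: mean_limit_bound h t0; exact: bmeasB.
Qed.

(** For [f - f] the bound reduces to [t^p * C], with [t] arbitrary. *)
Lemma mean_limit_unique f l l' : bmeas f -> mean_limit f l -> mean_limit f l' -> l = l'.
Proof.
move=> bf h h'; apply/eqP; rewrite -subr_eq0 -normr_le0; apply: le_powRC => t t0.
have := mean_limitB bf bf h h' t0.
under eq_Rintegral do rewrite subrr normr0 powR0 ?gt_eqF//.
by rewrite Rintegral_cst// mul0r !mulr0 add0r.
Qed.

Let int_pow_cvg0 (f_ : nat -> V -> R) f (c : R) : (forall k, bmeas (f_ k)) ->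
  (forall k x, `|f_ k x| <= c) -> (forall x, f_ ^~ x @ \oo --> f x) ->
  bmeas f /\ \int[m0]_x (`|f_ k x - f x| `^ q) @[k --> \oo] --> (0 : R).
Proof.
move=> bf_ f_c f_f.
have fc x : `|f x| <= c.
  apply: (@cvgr_to_le _ \oo _ R (fun k => `|f_ k x|) `|f x| c); first exact: cvg_norm (f_f x).
  by apply: nearW => k; exact: f_c.
have mf_ k : measurable_fun setT (f_ k : B -> R) by case: (bf_ k).
have mf : measurable_fun setT (f : B -> R).
  by apply: (@measurable_fun_cvg _ B R setT f_) => // x _; exact: f_f.
split; first by split => //; exists c.
have : \int[m0]_x (`|f_ k x - f x| `^ q) @[k --> \oo] --> \int[m0]_x (cst 0 x : R).
  apply: (@Rintegral_bounded_cvg _ B R m0 _ _ ((c + c) `^ q)).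
  - by move=> k; apply: mpow; exact: measurable_funB.
  - move=> k x; have fb : `|f_ k x - f x| <= c + c.
      by rewrite (le_trans (ler_normB _ _))// lerD.
    rewrite ger0_norm ?powR_ge0// ge0_ler_powR ?nnegrE ?(ltW q0)//.
    exact: le_trans fb.
  - move=> x; have fx : (f_ k x - f x) @[k --> \oo] --> (0 : R).
      by rewrite -(subrr (f x)); apply: cvgB; [exact: f_f|exact: cvg_cst].
    have := @continuous_cvg nat R R \oo _ (fun k => f_ k x - f x) (fun y : R => `|y| `^ q) 0
      (@continuous_norm_powR R q q0 0) fx.
    by rewrite normr0 powR0 ?gt_eqF//; exact.
by rewrite [X in _ --> X](_ : _ = 0)// Rintegral_cst// mul0r.
Qed.

Lemma mean_limit_continuous (f_ : nat -> V -> R) f (c : R) l_ l : (forall k, bmeas (f_ k)) ->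
  (forall k x, `|f_ k x| <= c) -> (forall x, f_ ^~ x @ \oo --> f x) ->
  (forall k, mean_limit (f_ k) (l_ k)) -> mean_limit f l -> l_ @ \oo --> l.
Proof.
move=> bf_ f_c f_f f_l fl.
have [bf f0] := int_pow_cvg0 bf_ f_c f_f.
apply/cvgrPdist_le => e e0.
have C1 : 0 < C + 1 by rewrite ltr_wpDl.
have [t t0 tC] : exists2 t, 0 < t & t `^ p * C <= e / 2.
  have : 0 < e / 2 by rewrite divr_gt0.
  move: (e / 2) => d d0; have dC : 0 < d / (C + 1) by rewrite divr_gt0.
  exists ((d / (C + 1)) `^ p^-1); first exact: powR_gt0.
  rewrite -powRrM mulVf ?gt_eqF// powRr1 ?(ltW dC)//.
  by rewrite -mulrA ler_piMr ?(ltW d0)// mulrC ler_pdivrMr// mul1r lerDl.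
pose K := t^-1 `^ q * c2.
have K0 : 0 < K by rewrite mulr_gt0// powR_gt0// invr_gt0.
have eK : 0 < e / 2 / K by rewrite !divr_gt0.
move/cvgrPdist_le/(_ _ eK) : f0; apply: filterS => k.
rewrite sub0r normrN => /(le_trans (ler_norm _)) hk.
rewrite distrC; apply: (le_trans (mean_limitB (bf_ k) bf (f_l k) fl t0)).
have : K * \int[m0]_x (`|f_ k x - f x| `^ q) <= K * (e / 2 / K) by rewrite ler_pM2l.
rewrite [X in _ <= X -> _]mulrC mulfVK ?gt_eqF// /K mulrA; lra.
Qed.

(** A cluster point of the bounded sequence [l_] is enough: [mean_limit] asks for one approximant
    per [e], which a single [f_ (s k)] far along the subsequence provides. *)
Lemma mean_limit_closed (f_ : nat -> V -> R) f (c : R) : (forall k, bmeas (f_ k)) ->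
  (forall k x, `|f_ k x| <= c) -> (forall x, f_ ^~ x @ \oo --> f x) ->
  (forall k, exists l, mean_limit (f_ k) l) -> exists l, mean_limit f l.
Proof.
move=> bf_ f_c f_f /choice[l_ hl_].
have [bf f0] := int_pow_cvg0 bf_ f_c f_f.
have [s sinc] : exists2 s : nat -> nat, increasing_seq s & cvgn (l_ \o s).
  apply: bolzano_weierstrass.
  (* The bound of [mean_limit_bound] at [t = 1], with |f_ k|^q replaced by c^q. *)
  exists (1^-1 `^ q * (c2 * \int[m0]_x (c `^ q)) + 1 `^ p * C); split; first exact: num_real.
  move=> M cM k _ /=; apply: le_trans (ltW cM).
  apply: (le_trans (mean_limit_bound (bf_ k) (hl_ k) ltr01)).
  rewrite lerD2r; apply: ler_wpM2l; first exact: powR_ge0.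
  apply: ler_wpM2l; first exact: ltW.
  apply: le_Rintegral => //.
  - exact: ibpow.
  - exact: integrable_cst.
  move=> x _; have c0 : 0 <= c by exact: le_trans (f_c k x).
  by rewrite ge0_ler_powR ?nnegrE ?(ltW q0).
move=> /cvg_ex[/= l hl]; exists l => e e0.
have e2 : 0 < e / 2 by rewrite divr_gt0.
have ec : 0 < e / 2 / c2 by rewrite divr_gt0.
have s_ge k : (k <= s k)%N.
  elim: k => // k IH; apply: (leq_ltn_trans IH).
  by have := sinc k.+1 k; rewrite leEnat ltnn => /negbT; rewrite -ltnNge.
have [k [hk1 hk2]] : exists k, `|\int[m0]_x (`|f_ (s k) x - f x| `^ q)| <= e / 2 / c2 /\
    `|l - l_ (s k)| <= e / 2.
  move/cvgrPdist_le/(_ _ ec) : f0 => [k1 _ hk1].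
  move/cvgrPdist_le/(_ _ e2) : hl => [k2 _ hk2].
  exists (maxn k1 k2); split; last by apply: hk2 => /=; exact: leq_maxr.
  have := hk1 (s (maxn k1 k2)); rewrite /= sub0r normrN; apply.
  by apply: leq_trans (s_ge _); exact: leq_maxl.
have min0 : 0 < Num.min (e / 2 / c2) (e / 2) by rewrite lt_min ec e2.
have [g [bg fg ag]] := hl_ (s k) _ min0.
exists g; split => //.
  apply: (le_trans (@int_powD (fun x => f_ (s k) x - f x) (fun x => f_ (s k) x - g x)
    (fun x => f x - g x) _ _ _ _)).
  - exact: bmeasB.
  - by apply: bmeasB => //; exact: bcont_bmeas.
  - by apply: bmeasB => //; exact: bcont_bmeas.
  - by move=> x; rewrite [X in _ <= X + _]distrC; exact: ler_distD.
  rewrite le_min in fg; move: fg => /andP[fg _].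
  have hk3 := le_trans (ler_norm _) hk1.
  apply: (le_trans (ler_wpM2l (ltW c20) (lerD hk3 fg))).
  have h : c2 * (e / 2 / c2) = e / 2 by rewrite mulrC mulfVK// gt_eqF.
  by rewrite mulrDr h -splitr.
apply: filterS ag => j; rewrite le_min => /andP[_ aj].
apply: (le_trans (ler_distD (l_ (s k)) _ _)).
by move: hk2; rewrite (distrC l); lra.
Qed.

(** The approximant [h] may be replaced by [g] itself: |g - h|^q is a test function of small
    [m0]-integral, so it has small [m j]-integral for large [j], and [mean_against_le] applies to
    [g - h]. *)
Lemma mean_limit_bcont g l : bcont g -> mean_limit g l -> a j g @[j --> \oo] --> l.
Proof.
move=> bg gl; apply/cvgrPdist_le => e e0.
have e3 : 0 < e / 3 by rewrite divr_gt0.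
have C1 : 0 < C + 1 by rewrite ltr_wpDl.
have [t t0 tC] : exists2 t, 0 < t & t `^ p * C <= e / 3.
  move: (e / 3) e3 => d d0; have dC : 0 < d / (C + 1) by rewrite divr_gt0.
  exists ((d / (C + 1)) `^ p^-1); first exact: powR_gt0.
  rewrite -powRrM mulVf ?gt_eqF// powRr1 ?(ltW dC)//.
  by rewrite -mulrA ler_piMr ?(ltW d0)// mulrC ler_pdivrMr// mul1r lerDl.
pose s := t^-1 `^ q.
have s0 : 0 < s by rewrite powR_gt0// invr_gt0.
(* The errors are [e / 3] from [t^p * C], [e / 3] from [s] times the integral of |g - h|^q, and at
   most [e / 6] from the value at [h]. *)
pose d := Num.min (e / 6 / s) (e / 6).
have d0 : 0 < d by rewrite lt_min !divr_gt0.
have [h [bh gh ah]] := gl d d0.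
have bgh : bcont (fun x : V => g x - h x).
  have := bcont_lin (-1) bh bg.
  by rewrite (_ : (fun x : V => _) = (fun x => g x - h x))//; apply/funext => x;
    rewrite mulN1r addrC.
have e6 : 0 < e / 6 / s by rewrite !divr_gt0.
have /cvgrPdist_le/(_ _ e6) hq := wm (bcont_powR bgh).
apply: filterS2 ah hq => j h1 h2.
have hb := mean_against_le j bgh t0.
have ab : a j (fun x : V => g x - h x) = a j g - a j h.
  have := mean_against_lin j (-1) bh bg; rewrite mulN1r addrC => <-.
  by congr mean_against; apply/funext => x; rewrite mulN1r addrC.
have h3 : s * \int[m j]_x (`|g x - h x| `^ q) <= s * (e / 6 / s + e / 6 / s).
  rewrite ler_pM2l//; move: h2; rewrite ler_norml => /andP[h2 _].
  have : d <= e / 6 / s by rewrite ge_min lexx.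
  by move=> ?; move: gh h2; lra.
rewrite mulrDr [s * (e / 6 / s)]mulrC mulfVK ?gt_eqF// in h3.
have h4 : d <= e / 6 by rewrite ge_min lexx orbT.
rewrite ab -/s in hb.
have := ler_distD (a j h) l (a j g).
rewrite [`|l - a j h|]distrC [`|a j h - a j g|]distrC.
move: hb h1 h3 h4 tC.
move: (\int[m j]_x (`|g x - h x| `^ q)) (t `^ p * C) `|a j g - a j h| `|a j h - l| `|l - a j g|.
by move=> *; lra.
Qed.

Section Representation.
Hypothesis a_bumps : forall s k, cvgn (fun j => a j (rbumps s k)).

Lemma mean_limit_exists f : bmeas f -> exists l, mean_limit f l.
Proof.
move=> [mf [c fc]]; suff [] : bmeas f /\ exists l, mean_limit f l by [].
apply: (functional_monotone_class (E := fun f => bmeas f /\ exists l, mean_limit f l)) mf fc.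
- move=> b g h [bg [lg hg]] [bh [lh hh]]; split; first exact: bmeas_lin.
  by exists (b * lg + lh); exact: mean_limit_lin.
- move=> s k; have bs := @bcont_bumps R n s k; split; first exact: bcont_bmeas.
  have /cvg_ex[/= l hl] := @a_bumps s k; exists l => e e0.
  exists (rbumps s k); split => //.
    under eq_Rintegral do rewrite subrr normr0 powR0 ?gt_eqF//.
    by rewrite Rintegral_cst// mul0r ltW.
  by move/cvgrPdist_le/(_ e e0) : hl; apply: filterS => j; rewrite distrC.
- move=> f_ g d Ef f_d f_g.
  have bf k : bmeas (f_ k) by case: (Ef k).
  split; first by have [] := int_pow_cvg0 bf f_d f_g.
  by apply: (mean_limit_closed bf f_d f_g) => k; case: (Ef k).
Qed.

Let bmeas_indic (A : set B) : measurable A -> bmeas (\1_A).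
Proof.
move=> mA; split; first exact: measurable_indic.
by exists 1 => x; rewrite indicE; case: (_ \in _); rewrite ?normr0 ?normr1.
Qed.

Lemma mean_limit_density : exists2 psi : V -> R,
  m0.-integrable setT (EFin \o (psi : B -> R)) &
  forall f, bmeas f -> mean_limit f (\int[m0]_x (f x * psi x)).
Proof.
(* Choice needs a value on every set; the condition on [nu] is void outside the Borel sets. *)
have /choice[nu nuP] : forall A : set B, exists l, measurable A -> mean_limit (\1_A) l.
  move=> A; have [mA|nA] := pselect (measurable A); last by exists 0.
  by have [l hl] := mean_limit_exists (bmeas_indic mA); exists l.
(* On an indicator the q-th power changes nothing, so the bound is by mass. Letting [t] tend to 0 on
   null sets gives absolute continuity. *)
have nu_small A (t : R) : measurable A -> 0 < t ->
    `|nu A| <= t^-1 `^ q * (c2 * fine (m0 A)) + t `^ p * C.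
  move=> mA t0; have := mean_limit_bound (bmeas_indic mA) (nuP A mA) t0.
  rewrite -Rintegral_indic//; congr (_ <= _ * (_ * _) + _).
  apply: eq_Rintegral => x _; rewrite indicE.
  by case: (_ \in _); rewrite ?normr1 ?powR1// normr0 powR0 ?gt_eqF.
have nu_null A : measurable A -> m0 A = 0%E -> nu A = 0.
  move=> mA mA0; apply/eqP; rewrite -normr_le0; apply: le_powRC => t t0.
  by have := nu_small A t mA t0; rewrite mA0 !mulr0 add0r.
have nu_set0 : nu set0 = 0 by apply: nu_null => //; rewrite measure0.
have nuU A A' : measurable A -> measurable A' -> A `&` A' = set0 ->
    nu (A `|` A') = nu A + nu A'.
  move=> mA mA' AA'; have mU := measurableU _ _ mA mA'.
  apply: (mean_limit_unique (bmeas_indic mU) (nuP _ mU)).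
  rewrite (_ : \1_(A `|` A') = (fun x : V => 1 * \1_A x + \1_A' x)).
    rewrite -[nu A]mul1r.
    exact: (mean_limit_lin 1 (bmeas_indic mA) (bmeas_indic mA') (nuP _ mA) (nuP _ mA')).
  apply/funext => x; rewrite mul1r !indicE in_setU.
  have [xA|] := boolP (x \in A); last by rewrite add0r.
  rewrite (_ : (x \in A') = false) ?addr0//; apply/negbTE/negP => xA'.
  have : (A `&` A') x by split; exact: set_mem.
  by rewrite AA'.
have nu_bigU F k : (forall i, measurable (F i)) -> trivIset setT F ->
    \sum_(0 <= i < k) nu (F i) = nu (\big[setU/set0]_(0 <= i < k) F i).
  move=> mF tF; elim: k => [|k IH]; first by rewrite !big_geq.
  rewrite !big_nat_recr//= IH nuU//; first by exact: bigsetU_measurable.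
  rewrite big_mkord; apply/seteqP; split => // x [].
  rewrite -bigcup_mkord => -[i /= ik Fi] Fk.
  have /trivIsetP/(_ i k Logic.I Logic.I) := tF.
  by rewrite (ltn_eqF ik) => /(_ isT) /seteqP[h _]; have := h x; exact.
have nu_sigma F : (forall i, measurable (F i)) -> trivIset setT F ->
    measurable (\bigcup_i F i) ->
    \sum_(0 <= i < k) nu (F i) @[k --> \oo] --> nu (\bigcup_i F i).
  move=> mF tF mUF; under eq_fun do rewrite nu_bigU//.
  have mb k : measurable (\big[setU/set0]_(0 <= i < k) F i) by exact: bigsetU_measurable.
  apply: (@mean_limit_continuous (fun k => \1_(\big[setU/set0]_(0 <= i < k) F i))
    (\1_(\bigcup_i F i)) 1).
  - by move=> k; exact: bmeas_indic.
  - by move=> k x; rewrite indicE; case: (_ \in _); rewrite ?normr0 ?normr1.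
  - move=> x; apply: cvg_near_cst.
    have [xF|xF] := boolP (x \in \bigcup_k F k).
      have [i _ Fi] := set_mem xF.
      near=> k; rewrite !indicE xF mem_set//.
      rewrite big_mkord -bigcup_mkord; exists i => //=.
      by near: k; exact: nbhs_infty_gt.
    near=> k; rewrite !indicE (negbTE xF) (_ : (x \in _) = false)//.
    apply/negbTE; move: xF; apply: contra => /set_mem.
    by rewrite big_mkord -bigcup_mkord => -[i _ Fi]; apply/mem_set; exists i.
  - by move=> k; exact: nuP.
  - exact: nuP.
have [psi ipsi nuE] := Radon_Nikodym_real nu_set0 nu_sigma nu_null.
exists psi => // f [mf [c fc]].
have mpsi : measurable_fun setT (psi : B -> R).
  by apply/measurable_EFinP; exact: (measurable_int m0).
have ifpsi g : bmeas g -> m0.-integrable setT (EFin \o (fun x : B => g x * psi x)).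
  move=> [mg [b gb]]; apply: (integrableMr (mu := m0) measurableT mg _ ipsi).
  exists b; split; first exact: num_real.
  by move=> M bM x _ /=; apply: le_trans (gb x) (ltW bM).
(* The representation goes from indicators to bounded Borel functions. At a bounded limit,
   [mean_limit_exists] supplies some [l]; it is identified by comparing [mean_limit_continuous] with
   dominated convergence. *)
suff [] : bmeas f /\ mean_limit f (\int[m0]_x (f x * psi x)) by [].
apply: (@bounded_measurable_ind _ B R
  (fun f => bmeas f /\ mean_limit f (\int[m0]_x (f x * psi x)))) mf fc.
- move=> b g h [bg hg] [bh hh]; split; first exact: bmeas_lin.
  under eq_Rintegral do rewrite mulrDl -mulrA.
  rewrite RintegralD//; [|exact: (integrableZl measurableT b (ifpsi _ bg))|exact: ifpsi].
  rewrite RintegralZl//; last exact: ifpsi.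
  exact: mean_limit_lin.
- move=> A mA; split; first exact: bmeas_indic.
  by rewrite -nuE//; exact: nuP.
- move=> f_ g d Ef f_d f_g.
  have bf k : bmeas (f_ k) by case: (Ef k).
  have [bg _] := int_pow_cvg0 bf f_d f_g.
  split => //; have [l hl] := mean_limit_exists bg.
  have hf k : mean_limit (f_ k) (\int[m0]_x (f_ k x * psi x)) by case: (Ef k).
  have c1 := mean_limit_continuous bf f_d f_g hf hl.
  have c2' : \int[m0]_x (f_ k x * psi x) @[k --> \oo] --> \int[m0]_x (g x * psi x).
    apply: (@Rintegral_dominated _ B R m0 _ _ (fun x => d * `|psi x|)).
    + by move=> k; apply: measurable_funM => //; case: (bf k).
    + exact: (integrableZl measurableT d (integrable_norm ipsi)).
    + by move=> k x; rewrite normrM ler_wpM2r.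
    + by move=> x; apply: cvgM; [exact: f_g|exact: cvg_cst].
  by rewrite (cvg_unique _ c2' c1).
Unshelve. all: by end_near. Qed.

End Representation.

(* Test [psi] against [sgn psi * |psi|^(p-1)] truncated to [|psi| <= N]; with [t = 4] the
   constant in front of the q-norm in [mean_limit_bound] is at most 1/2. *)
Lemma density_Lp (psi : V -> R) : m0.-integrable setT (EFin \o (psi : B -> R)) ->
  (forall f, bmeas f -> mean_limit f (\int[m0]_x (f x * psi x))) ->
  (\int[m0]_x (`|psi x| `^ p)%:E < +oo)%E.
Proof.
move=> ipsi psiP.
have mpsi : measurable_fun setT (psi : B -> R).
  by apply/measurable_EFinP; exact: (measurable_int m0).
have mnpsi : measurable_fun setT (fun x : B => `|psi x|) by exact: measurableT_comp.
have mpw (r : R) : measurable_fun setT (fun x : B => `|psi x| `^ r).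
  exact: (measurableT_comp (measurable_powR r)).
pose A N : set B := [set x | `|psi x| <= N].
have mA N : measurable (A N) by exact: measurable_set_le.
pose S : set B := [set x | 0 <= psi x].
have mS : measurable S by exact: measurable_set_le.
(* The value at the zeros of [psi] is 1, so that [|sgn|] is 1 everywhere. *)
pose sgn (x : V) : R := 2 * \1_S x - 1.
have sgnE x : sgn x * psi x = `|psi x|.
  rewrite /sgn indicE; have [/set_mem/= x0|/negP x0] := boolP (x \in S).
    by rewrite ger0_norm//= mulr1; ring.
  rewrite ltr0_norm/=; first by rewrite mulr0; ring.
  by rewrite ltNge; apply/negP => h; apply: x0; exact/mem_set.
have sgn1 x : `|sgn x| = 1.
  rewrite /sgn indicE; case: (x \in S).
    by rewrite (_ : _ - _ = 1) ?normr1//= mulr1; ring.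
  by rewrite mulr0 sub0r normrN normr1.
pose f N (x : V) : R := \1_(A N) x * (sgn x * `|psi x| `^ (p - 1)).
pose K := 2 * (4 `^ p * C).
have p10 : 0 < p - 1 by rewrite subr_gt0.
have key (N : nat) : \int[m0]_x (\1_(A N%:R) x * `|psi x| `^ p) <= K.
  have bf : bmeas (f N%:R).
    split.
      apply: measurable_funM; first exact: measurable_indic.
      apply: measurable_funM => //; apply: measurable_funB; last exact: measurable_cst.
      by apply: measurable_funM; [exact: measurable_cst|exact: measurable_indic].
    exists (N%:R `^ (p - 1)) => x; rewrite /f !normrM sgn1 mul1r indicE.
    have [/set_mem/= xN|] := boolP (x \in A _); last by rewrite normr0 mul0r powR_ge0.
    by rewrite normr1 mul1r ger0_norm ?powR_ge0// ge0_ler_powR ?nnegrE ?(ltW p10).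
  have fpsi x : f N%:R x * psi x = \1_(A N%:R) x * `|psi x| `^ p.
    rewrite /f -mulrA; congr (_ * _); rewrite mulrAC sgnE.
    by rewrite mulr_powRB1// ltW.
  have fq x : `|f N%:R x| `^ q = \1_(A N%:R) x * `|psi x| `^ p.
    rewrite /f indicE; case: (x \in A _); last first.
      by rewrite mul0r normr0 powR0 ?gt_eqF// mul0r.
    rewrite !mul1r normrM sgn1 mul1r ger0_norm ?powR_ge0// -powRrM.
    by rewrite /q mulrCA divff ?gt_eqF// mulr1.
  have := mean_limit_bound bf (psiP _ bf) (ltr0Sn R 3).
  under eq_Rintegral do rewrite fpsi.
  under [in X in _ <= X -> _]eq_Rintegral do rewrite fq.
  set X := \int[m0]_x _ => hX.
  have X0 : 0 <= X.
    by apply: Rintegral_ge0 => x _; rewrite mulr_ge0 ?powR_ge0// indicE.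
  have half : 4^-1 `^ q * c2 <= 2^-1.
    rewrite /c2 -powRM ?invr_ge0// (_ : 4^-1 * 2 = 2^-1); last by field.
    by apply: ge1r_powR; [apply/andP; split; lra|exact: ltW].
  have h1 : 4^-1 `^ q * (c2 * X) <= 2^-1 * X by rewrite mulrA ler_wpM2r.
  (* [X <= X / 2 + 4^p * C], solved for [X]; the truncation to [A N] makes the test function bounded
     and [X] finite. The bound [K] does not depend on [N], which allows monotone convergence. *)
  have := ler_norm X; rewrite /K; lra.
have gcvg := @cvg_monotone_convergence _ B R m0 setT measurableT
  (fun N x => (\1_(A N%:R) x * `|psi x| `^ p)%:E).
have gm N : measurable_fun setT (fun x : B => (\1_(A N%:R) x * `|psi x| `^ p)%:E).
  apply/measurable_EFinP; apply: measurable_funM => //; exact: measurable_indic.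
have g0 N (x : B) : setT x -> (0 <= (\1_(A N%:R) x * `|psi x| `^ p)%:E)%E.
  by move=> _; rewrite lee_fin mulr_ge0 ?powR_ge0// indicE.
have gnd (x : B) : setT x -> {homo (fun N : nat => (\1_(A N%:R) x * `|psi x| `^ p)%:E)
    : N M / (N <= M)%N >-> (N <= M)%E}.
  move=> _ N M NM; rewrite lee_fin ler_wpM2r ?powR_ge0// !indicE ler_nat.
  have [/set_mem/= xN|//] := boolP (x \in A N%:R).
  by rewrite mem_set//= /A/= (le_trans xN)// ler_nat.
have {gcvg} := gcvg gm g0 gnd.
have -> : (\int[m0]_x limn (fun N : nat => (\1_(A N%:R) x * `|psi x| `^ p)%:E) =
    \int[m0]_x (`|psi x| `^ p)%:E)%E.
  apply: eq_integral => x _; apply/cvg_lim => //; apply: cvg_near_cst.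
  near=> N; rewrite indicE mem_set ?mul1r//= /A/=.
  by near: N; exact: nbhs_infty_ger.
move=> hlim; rewrite -(cvg_lim _ hlim)//; apply: (@le_lt_trans _ _ K%:E); last exact: ltry.
apply: lime_le; first by apply/cvg_ex; eexists; exact: hlim.
apply: nearW => N; rewrite -[leLHS]fineK ?lee_fin; first exact: key.
apply: (integrable_fin_num measurableT).
apply: (@bounded_integrable _ B R m0 _ (N%:R `^ p)).
  by apply/measurable_EFinP; exact: gm.
move=> x; rewrite indicE; have [/set_mem/= xN|_] := boolP (x \in A _).
  by rewrite mul1r ger0_norm ?powR_ge0// ge0_ler_powR ?nnegrE ?(ltW p0).
by rewrite mul0r normr0 powR_ge0.
Unshelve. all: by end_near. Qed.

End WeakLimit.



Lemma homo_ltn_cvgny (phi : nat -> nat) : {homo phi : i j / (i < j)%N} ->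
  phi @ \oo --> \oo.
Proof.
move=> inc; apply/cvgnyPge => N; near=> j.
have : (N <= j)%N by near: j; exact: nbhs_infty_ge.
move=> /leq_trans; apply; elim: (j) => // i IH; apply: (leq_ltn_trans IH); exact: inc.
Unshelve. all: by end_near. Qed.

Section WeakCompactness.
Context {R : realType} {n : nat}.
Local Notation V := 'rV[R]_n.
Local Notation B := (Bn R n).

Lemma weakly_cvg_comp (m : nat -> {finite_measure set B -> \bar R})
    (m0 : {finite_measure set B -> \bar R}) (phi : nat -> nat) :
  {homo phi : i j / (i < j)%N} -> weakly_cvg m m0 -> weakly_cvg (m \o phi) m0.
Proof.
move=> inc wm h bh; have := wm h bh; apply: cvg_trans.
exact: (cvg_app (fun j => \int[m j]_x h x) (homo_ltn_cvgny inc)).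
Qed.

(** The extraction secures convergence on countably many bumps only; [mean_limit_density] extends
    the functional to bounded Borel functions, and [mean_limit_bcont] reads off convergence for
    every test function. *)
Lemma weak_compactness (m : nat -> {finite_measure set B -> \bar R})
    (m0 : {finite_measure set B -> \bar R}) (u : V -> R) (p C : R) :
  weakly_cvg m m0 -> 1 < p -> measurable_fun setT (u : B -> R) ->
  (forall j, (\int[m j]_x (`|u x| `^ p)%:E <= C%:E)%E) ->
  exists2 phi : nat -> nat, {homo phi : i j / (i < j)%N} &
  exists psi : V -> R, [/\ measurable_fun setT (psi : B -> R),
    m0.-integrable setT (EFin \o (psi : B -> R)),
    (\int[m0]_x (`|psi x| `^ p)%:E < +oo)%E &
    forall h, bcont h ->
      \int[m (phi j)]_x (h x * u x) @[j --> \oo] --> \int[m0]_x (h x * psi x)].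
Proof.
move=> wm p1 mu uC.
pose F k : seq ('rV[rat]_n * rat) * nat := odflt ([::], 0%N) (unpickle k).
have [M M0 massM] : exists2 M : R, 0 <= M & forall j, fine (m j setT) <= M.
  have : cvgn (fun j => fine (m j setT)).
    by apply/cvg_ex; exists (fine (m0 setT)); exact: weakly_cvg_mass.
  move=> /cvg_seq_bounded[M [_ hM]].
  have h j : `|fine (m j setT)| <= M + 1 by apply: hM; rewrite ?ltrDl.
  exists (M + 1); first exact: le_trans (h 0%N).
  by move=> j; apply: le_trans (ler_norm _) (h j).
have C0 : 0 <= C.
  rewrite -lee_fin; apply: le_trans (uC 0%N); apply: integral_ge0 => x _.
  by rewrite lee_fin powR_ge0.
have [phi inc hphi] : exists2 phi : nat -> nat, {homo phi : i j / (i < j)%N} &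
    forall k, cvgn (fun j => mean_against m u (phi j) (rbumps (F k).1 (F k).2)).
  apply: (@diagonal_subsequence R (fun k j => mean_against m u j (rbumps (F k).1 (F k).2))).
  move=> k; pose g : V -> R := rbumps (F k).1 (F k).2.
  (* Since [|g| <= 1], the product [|g * u|] is at most [1 + |u|^p], and [M] bounds the masses. *)
  exists (M + C) => j.
  have bg : bcont g by exact: bcont_bumps.
  have [i1 i2 i3] := pintegrable p1 mu (uC j).
  have g1 x : `|g x| <= 1.
    by have /andP[? ?] := bumps_itv (map ratpair (F k).1) (F k).2 x; rewrite ger0_norm.
  have ig := integrable_bcont_mul bg i1.
  apply: (le_trans (le_normr_Rintegral (mu := m j) measurableT ig)).
  have k1 := integrable_cst (m j) 1.
  apply: (@le_trans _ _ (\int[m j]_x (1 + `|u x| `^ p))).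
    apply: le_Rintegral => //.
    - exact: integrable_norm.
    - exact: (integrableD measurableT k1 i2).
    move=> x _; apply: le_trans (le1D_powR _ p1).
    by rewrite normrM ler_piMl.
  rewrite RintegralD// Rintegral_cst// mul1r.
  by apply: lerD; [exact: massM|exact: i3].
have wm' := weakly_cvg_comp inc wm.
have uC' j : (\int[(m \o phi) j]_x (`|u x| `^ p)%:E <= C%:E)%E by exact: uC.
have abumps s k : cvgn (fun j => mean_against (m \o phi) u j (rbumps s k)).
  by have := hphi (pickle (s, k)); rewrite /F pickleK.
have [psi ipsi psiP] := mean_limit_density wm' p1 mu uC' abumps.
exists phi => //; exists psi; split => //.
- by apply/measurable_EFinP; exact: (measurable_int m0).
- exact: density_Lp ipsi psiP.
move=> h bh; apply: (mean_limit_bcont wm' p1 mu uC' bh).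
apply: psiP; split; [exact: bcont_measurable|by case: bh].
Qed.

End WeakCompactness.

(** * Boundary values *)




(** Weak compactness gives only subsequences; this recovers convergence of the means of [u] along a
    whole sequence. *)
Lemma subsubsequence_cvg {R : realType} (x : nat -> R) (l : R) :
  (forall s : nat -> nat, {homo s : i j / (i < j)%N} ->
    exists2 t : nat -> nat, {homo t : i j / (i < j)%N} & x (s (t j)) @[j --> \oo] --> l) ->
  x @ \oo --> l.
Proof.
move=> xs; apply: contrapT => nx.
have [e e0 he] : exists2 e : R, 0 < e & forall N : nat, exists j, (N < j)%N /\ e < `|l - x j|.
  apply: contrapT => h; apply: nx; apply/cvgrPdist_le => e e0.
  apply: contrapT => he; apply: h; exists e => // N; apply: contrapT => hN; apply: he.
  exists N.+1 => // j /= Nj; rewrite leNgt; apply/negP => xj.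
  by apply: hN; exists j.
have /choice[g hg] := he.
pose s := fix s k : nat := if k is k'.+1 then g (s k') else g 0%N.
have sinc : {homo s : i j / (i < j)%N}.
  move=> i j; elim: j => // j IH; rewrite ltnS leq_eqVlt => /predU1P[->|/IH ij].
    by have [] := hg (s j).
  by apply: (ltn_trans ij); have [] := hg (s j).
have [t _ /cvgrPdist_le/(_ _ e0)[N _ /(_ N (leqnn N))]] := xs s sinc.
apply/negP; rewrite -ltNge.
by case: (t N) => [|k] /=; [have [] := hg 0%N|have [] := hg (s k)].
Qed.

Section MeasureLemmas.
Context d (T : measurableType d) (R : realType).

Lemma finite_measure_of (m : {measure set T -> \bar R}) : (m setT < +oo)%E ->
  exists m' : {finite_measure set T -> \bar R}, (m' : set T -> \bar R) = m.
Proof.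
move=> moo; exists (mfrestr measurableT moo).
by apply/funext => A; exact: (congr1 m (setIT A)).
Qed.

Lemma integral_conull (m : {measure set T -> \bar R}) (A : set T) (f : T -> \bar R) :
  measurable A -> m (~` A) = 0%E -> m.-integrable setT f ->
  (\int[m]_(x in A) f x = \int[m]_x f x)%E.
Proof.
move=> mA mA0 fi; rewrite [RHS](negligible_integral (measurableC mA))//.
by rewrite setDE setTI setCK.
Qed.

Lemma ge0_integral_conull (m : {measure set T -> \bar R}) (A : set T) (f : T -> \bar R) :
  measurable A -> m (~` A) = 0%E -> measurable_fun setT f ->
  (forall x, 0 <= f x)%E -> (\int[m]_(x in A) f x = \int[m]_x f x)%E.
Proof.
move=> mA mA0 mf f0.
by rewrite [RHS](ge0_negligible_integral (measurableC mA))// setDE setTI setCK.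
Qed.

Lemma measure0_subset (m : {measure set T -> \bar R}) (A C : set T) :
  measurable A -> measurable C -> A `<=` C -> m C = 0%E -> m A = 0%E.
Proof.
move=> mA mC AC mC0; apply/eqP; rewrite eq_le measure_ge0 andbT -mC0.
by apply: le_measure => //; rewrite inE.
Qed.

End MeasureLemmas.

(** * Supports, measurability of [Pop], extension of test functions *)

Section Support.
Context {R : realType} {n : nat}.
Local Notation V := 'rV[R]_n.
Local Notation B := (Bn R n).
Implicit Types m : {measure set B -> \bar R}.

Lemma closed_bdry (A : set V) : closed (bdry A).
Proof.
rewrite /bdry setDE; apply: closedI; first exact: closed_closure.
by apply: open_closedC; exact: open_interior.
Qed.

Lemma supp_sub m (A : set V) : closed A -> m (~` A) = 0%E -> supp m `<=` A.
Proof.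
move=> cA mA x sx; apply: contrapT => nAx.
by have := sx (~` A) (closed_openC cA) nAx; rewrite mA ltxx.
Qed.

Lemma suppC_open m : open (~` supp m).
Proof.
rewrite openE => x /= nx; have [U [oU Ux mU]] : exists U : set V, [/\ open U, U x & m U = 0%E].
  apply: contrapT => h; apply: nx => U oU Ux; rewrite lt_neqAle measure_ge0 andbT.
  by apply/eqP => m0; apply: h; exists U; split.
have Un : nbhs x U by exact: open_nbhs_nbhs.
apply: filterS Un => y Uy sy.
by have := sy U oU Uy; rewrite mU ltxx.
Qed.

(** Each point off the support lies in a null rational ball, and there are countably many of
    these. *)
Lemma supp_conull m : m (~` supp m) = 0%E.
Proof.
pose q k : 'rV[rat]_n * rat := odflt (0, 0) (unpickle k).
pose U k : set V := [set y | `|y - ratmx (q k).1| < ratr (q k).2].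
have mU k : measurable (U k : set B).
  by apply: open_measurable_Bn; exact: open_rat_ball.
pose G k : set B := if m (U k) == 0%E then U k else set0.
have mG k : measurable (G k) by rewrite /G; case: ifP.
have G0 : m.-negligible (\bigcup_k G k).
  apply: negligible_bigcup => k; apply/negligibleP => //.
  by rewrite /G; case: ifP => [/eqP|_]; last rewrite measure0.
apply/negligibleP; first by apply: open_measurable_Bn; exact: suppC_open.
apply: negligibleS G0 => x nx.
have [W [oW Wx W0]] : exists W : set V, [/\ open W, W x & m W = 0%E].
  apply: contrapT => h; apply: nx => W oW Wx; rewrite lt_neqAle measure_ge0 andbT.
  by apply/eqP => m0; apply: h; exists W; split.
have [p [px pW]] := rat_ball_basis oW Wx.
exists (pickle p) => //; have Up : U (pickle p) = [set y | `|y - ratmx p.1| < ratr p.2].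
  by rewrite /U /q pickleK.
rewrite /G Up (_ : m _ == 0%E = true)//; apply/eqP.
by apply: (measure0_subset _ _ _ W0) => //; [rewrite -Up|exact: open_measurable_Bn].
Qed.

Lemma measurable_supp m : measurable (supp m : set B).
Proof.
rewrite -(setCK (supp m)); apply: measurableC; apply: open_measurable_Bn.
exact: suppC_open.
Qed.

End Support.

Section PoissonMeasurable.
Context {R : realType} {n : nat}.
Local Notation V := 'rV[R]_n.
Local Notation B := (Bn R n).

(** The integral in [Pop] may diverge, so the positive and negative parts of the integrand go
    separately through Fubini-Tonelli, after extension by 0 outside the product of [D] and
    [supp mu], on which [P] is Borel. *)
Lemma measurable_Pop (D A : set V) (mu : {measure set B -> \bar R}) (P : V -> V -> R)
    (psi : V -> R) : open D -> closed A -> (mu setT < +oo)%E -> mu (~` A) = 0%E ->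
  measurable_fun (D `*` A : set (B * B)) (fun zw : B * B => P zw.1 zw.2) ->
  measurable_fun setT (psi : B -> R) ->
  measurable_fun (D : set B) (Pop mu P psi : B -> R).
Proof.
move=> oD cA muoo muA mP mpsi.
have [m0 m0E] := finite_measure_of muoo.
have mD := open_measurable_Bn oD.
have mS := measurable_supp mu.
have mDS : measurable (D `*` supp mu : set (B * B)) by exact: measurableX.
pose G := (fun zw : B * B => psi zw.2 * P zw.1 zw.2) \_ (D `*` supp mu : set (B * B)).
have mG : measurable_fun setT (EFin \o G).
  apply/measurable_EFinP; apply/(measurable_restrictT _ mDS).
  apply: measurable_funM.
    by apply: measurable_funTS; apply: (measurableT_comp mpsi); exact: measurable_snd.
  apply: measurable_funS mP; first by apply: measurableX => //; exact: closed_measurable_Bn.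
  by move=> -[z x] [/= Dz sx]; split => //=; exact: supp_sub muA _ sx.
have mp := measurable_fun_fubini_tonelli_F (m2 := m0) _ (measurable_funepos mG)
  (fun x => funepos_ge0 _ x).
have mn := measurable_fun_fubini_tonelli_F (m2 := m0) _ (measurable_funeneg mG)
  (fun x => funeneg_ge0 _ x).
apply: (eq_measurable_fun (fun z : B =>
  fine (fubini_F m0 (EFin \o G)^\+ z - fubini_F m0 (EFin \o G)^\- z)%E)).
  move=> z /set_mem Dz; rewrite /Pop integral_mkcond -m0E integralE.
  rewrite /fubini_F; congr (fine (_ - _)%E).
    apply: eq_integral => x _; rewrite !funeposE /= patchE /G patchE.
    rewrite (_ : ((z, x) \in D `*` supp mu) = (x \in supp mu)); last first.
      by apply/idP/idP => /set_mem; [case=> _ /mem_set|move=> sx; apply/mem_set].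
    by case: ifP.
  apply: eq_integral => x _; rewrite !funenegE /= patchE /G patchE.
  rewrite (_ : ((z, x) \in D `*` supp mu) = (x \in supp mu)); last first.
    by apply/idP/idP => /set_mem; [case=> _ /mem_set|move=> sx; apply/mem_set].
  by case: ifP.
apply: measurable_funTS; apply: measurableT_comp => //.
exact: emeasurable_funB.
Qed.

End PoissonMeasurable.

Section ContinuousExtension.
Context {R : realType} {n : nat}.
Local Notation V := 'rV[R]_n.

Lemma bcont_extension (K : set V) (h : V -> R) : compact K ->
  {within K, continuous h} -> exists2 g, bcont g & forall x, K x -> h x = g x.
Proof.
move=> cK ch.
have [M [_ hM]] := compact_bounded (continuous_compact ch cK).
(* The added 1 makes the bound positive, as Tietze's theorem requires, and strictly larger than
   [M]. *)
have M1 : forall x, K x -> `|h x| <= `|M| + 1.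
  move=> x Kx; apply: (hM (`|M| + 1)); last by exists x.
  by rewrite (le_lt_trans (ler_norm M))// ltrDl.
have [g [hg cg gM]] := @continuous_bounded_extension V R (@pseudometric_normal R V) K
  (compact_closed (@norm_hausdorff R V) cK) h (`|M| + 1) (ltr_wpDl (normr_ge0 M) ltr01) ch M1.
exists g; first by split => //; exists (`|M| + 1).
by move=> x Kx; apply: hg; exact: mem_set.
Qed.

Lemma bounded_closure_compact (D : set V) : bounded_set D -> compact (closure D).
Proof.
move=> bD; apply: bounded_closed_compact; last exact: closed_closure.
have [M [Mr hM]] := bD; exists M; split => // N MN.
have cN : closed [set x : V | `|x| <= N].
  exact: (closed_comp (fun x _ => @norm_continuous R V x) (@closed_le R N)).
move=> x clx.
have : closure [set x : V | `|x| <= N] x.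
  by apply: closureS clx => y; exact: hM.
by rewrite -(proj1 (closure_id _) cN).
Qed.

End ContinuousExtension.




(** * Boundary values and means along sequences *)

Section BoundaryValues.
Context {R : realType} {n : nat}.
Local Notation V := 'rV[R]_n.
Local Notation B := (Bn R n).
Variables (D : set V) (Dr : R -> set V) (mur : R -> {measure set B -> \bar R})
  (mu : {measure set B -> \bar R}) (p : R) (m0 : {finite_measure set B -> \bar R}).
Hypotheses (oD : open D) (hDb : bounded_set D)
  (hDrDs : forall r s : R, r < s -> s < 0 ->
     compact (closure (Dr r)) /\ closure (Dr r) `<=` Dr s)
  (hDunion : \bigcup_(r in [set r : R | r < 0]) Dr r = D)
  (hmur_fin : forall r : R, r < 0 -> (mur r setT < +oo)%E)
  (hmur_supp : forall r : R, r < 0 -> mur r (~` bdry (Dr r)) = 0%E)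
  (m0E : (m0 : set B -> \bar R) = mu)
  (hmu_supp : mu (~` bdry D) = 0%E)
  (hweak : forall h : V -> R, {within closure D, continuous h} ->
     (fun r : R => (\int[mur r]_(x in (closure D : set B)) (h x)%:E)%E)
       @ (0:R)^'- --> (\int[mu]_(x in (closure D : set B)) (h x)%:E)%E)
  (p1 : 1 < p).

Let mD : measurable (D : set B). Proof. exact: open_measurable_Bn. Qed.

Let mK : measurable (closure D : set B).
Proof. by apply: closed_measurable_Bn; exact: closed_closure. Qed.

Let bdry_subD r : r < 0 -> bdry (Dr r) `<=` D.
Proof.
move=> r0 x [clx _]; rewrite -hDunion; have r2 : r < r / 2 by lra.
have r20 : r / 2 < 0 by lra.
by exists (r / 2) => //; have [_] := hDrDs r2 r20; exact.
Qed.

Let mur_DC r : r < 0 -> mur r (~` D) = 0%E.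
Proof.
move=> r0; apply: (measure0_subset _ _ _ (hmur_supp r0)); first exact: measurableC.
  by apply: measurableC; apply: closed_measurable_Bn; exact: closed_bdry.
by apply: subsetC; exact: bdry_subD.
Qed.

Let mur_KC r : r < 0 -> mur r (~` closure D) = 0%E.
Proof.
move=> r0; apply: (measure0_subset _ _ _ (mur_DC r0)); try exact: measurableC.
by apply: subsetC; exact: subset_closure.
Qed.

Let mu_KC : mu (~` closure D) = 0%E.
Proof.
apply: (measure0_subset _ _ _ hmu_supp); first exact: measurableC.
  by apply: measurableC; apply: closed_measurable_Bn; exact: closed_bdry.
by apply: subsetC => x [].
Qed.

Let supp_subD r : r < 0 -> supp (mur r) `<=` D.
Proof.
move=> r0 x /(supp_sub (@closed_bdry _ _ _) (hmur_supp r0)); exact: bdry_subD.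
Qed.

Lemma seq_to0_comp (r : nat -> R) (phi : nat -> nat) :
  {homo phi : i j / (i < j)%N} -> seq_to0 r -> seq_to0 (r \o phi).
Proof.
move=> inc [r0 [nd rc]]; split; first by move=> j; exact: r0.
split; first by move=> i j ij /=; apply: nd; exact: (ltnW_homo inc).
by apply: cvg_comp rc; exact: homo_ltn_cvgny.
Qed.

Lemma seq_to0_at_left (r : nat -> R) : seq_to0 r -> r @ \oo --> (0 : R)^'-.
Proof.
move=> [r0 [_ rc]] A /= hA; have := rc _ hA; rewrite /nbhs/=.
by apply: filterS => j /=; apply.
Qed.

Lemma seq_finite_measures (r : nat -> R) : seq_to0 r ->
  exists m : nat -> {finite_measure set B -> \bar R},
    forall j, (m j : set B -> \bar R) = mur (r j).
Proof.
move=> [r0 _].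
have /choice[m hm] : forall j, exists m : {finite_measure set B -> \bar R},
    (m : set B -> \bar R) = mur (r j).
  by move=> j; exact: finite_measure_of (hmur_fin (r0 j)).
by exists m.
Qed.

Section AlongSequence.
Variables (r : nat -> R) (m : nat -> {finite_measure set B -> \bar R}).
Hypotheses (hr : seq_to0 r) (mE : forall j, (m j : set B -> \bar R) = mur (r j)).

Let r0 j : r j < 0. Proof. by case: hr. Qed.

Lemma seq_weakly_cvg : weakly_cvg m m0.
Proof.
move=> h bh; have ch : {within closure D, continuous h}.
  by apply: continuous_subspaceT; case: bh.
have hc := cvg_comp _ _ (seq_to0_at_left hr) (hweak ch).
apply: (fine_cvg (a := \int[m0]_x h x)).
rewrite fineK; last by apply: (integrable_fin_num measurableT); exact: bcont_integrable.
have e0 : (\int[mu]_(x in (closure D : set B)) (h x)%:E = \int[m0]_x (h x)%:E)%E.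
  rewrite -m0E; apply: integral_conull => //; last exact: bcont_integrable.
  by rewrite -[LHS]/((m0 : set B -> \bar R) (~` closure D)) m0E.
rewrite e0 in hc; apply: cvg_trans hc; apply: near_eq_cvg; apply: nearW => j /=.
rewrite -mE; apply: integral_conull => //; last exact: bcont_integrable.
by rewrite -[LHS]/((m j : set B -> \bar R) (~` closure D)) mE mur_KC.
Qed.

Lemma seq_near (e : R) : 0 < e -> exists N, forall j, (N <= j)%N -> - e < r j < 0.
Proof.
move=> e0; have [_ [_ /cvgrPdist_lt/(_ e e0)[N _ hN]]] := hr.
exists N => j /hN/=; rewrite sub0r normrN ltr_norml => /andP[-> _].
by rewrite r0.
Qed.

End AlongSequence.

(** A finite limsup bounds the integrals only for [r] near 0; this is why sequences are shifted by
    some [N] below. *)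
Lemma norm_p_bound (f : V -> R) : measurable_fun (D : set B) (f : B -> R) ->
  (norm_p Dr mur p f < +oo)%E -> exists e C : R, 0 < e /\ forall r, - e < r < 0 ->
    (\int[mur r]_x (`|(f \_ D) x| `^ p)%:E <= C%:E)%E.
Proof.
move=> mf /ereal_inf_lt[_ [e /= e0 <-]] hS.
set S := ereal_sup _ in hS.
have hI r : - e < r < 0 -> (\int[mur r]_x (`|(f \_ D) x| `^ p)%:E <= S)%E.
  move=> /[dup] rr /andP[_ r0].
  have mb : measurable (bdry (Dr r) : set B).
    by apply: closed_measurable_Bn; exact: closed_bdry.
  have mfD := measurable_patch oD mf.
  have mg : measurable_fun setT (fun x : B => (`|(f \_ D) x| `^ p)%:E).
    apply/measurable_EFinP; apply: (measurableT_comp (measurable_powR p)).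
    exact: measurableT_comp.
  rewrite -(ge0_integral_conull mb (hmur_supp r0) mg); last first.
    by move=> x; rewrite lee_fin powR_ge0.
  apply: ereal_sup_ubound; exists r => //.
  apply: eq_integral => x /set_mem /(bdry_subD r0) Dx.
  by rewrite patchE mem_set.
exists e, (fine S); split => // r rr.
have I0 : (0 <= \int[mur r]_x (`|(f \_ D) x| `^ p)%:E)%E.
  by apply: integral_ge0 => x _; rewrite lee_fin powR_ge0.
by have := hI r rr; have := I0; case: S hS {hI} => [s|//|] //= _ /le_trans/[apply].
Qed.

Let ae_eq_supp (f g : V -> R) : {ae mu, forall x : B, supp mu x -> f x = g x} ->
  exists2 N : set B, measurable N /\ mu N = 0%E & forall x, supp mu x -> ~ N x -> f x = g x.
Proof.
move=> [N [mN N0 sub]]; exists N => // x sx nN; apply: contrapT => fg.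
by apply: nN; apply: sub => /= h; apply: fg; exact: h.
Qed.

(** Brings [strong_limit] into the form used by [strong_limit_mean]: [phis] becomes [psi] off the
    null sets [N1] and [N2], and [w] becomes its extension by 0. *)
Lemma boundary_values_mean (w ustar psi : V -> R) (r : nat -> R)
    (m : nat -> {finite_measure set B -> \bar R}) :
  measurable_fun (D : set B) (w : B -> R) -> (norm_p Dr mur p w < +oo)%E ->
  is_boundary_values D mur mu w ustar ->
  {ae mu, forall x : B, supp mu x -> ustar x = psi x} ->
  measurable_fun setT (psi : B -> R) -> m0.-integrable setT (EFin \o (psi : B -> R)) ->
  seq_to0 r -> (forall j, (m j : set B -> \bar R) = mur (r j)) ->
  \int[m j]_x (w \_ D) x @[j --> \oo] --> \int[m0]_x psi x.
Proof.
move=> mw nw [_ bw] upsi mpsi ipsi hr mE.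
have [e [C [e0 wC]]] := norm_p_bound mw nw.
have [N hN] := seq_near hr e0.
have [phis [[_ phisS] phisu]] := bw r hr.
have [N1 [mN1 N10] phisE] := ae_eq_supp phisu.
have [N2 [mN2 N20] upsiE] := ae_eq_supp upsi.
have mwD := measurable_patch oD mw.
have wmr : weakly_cvg (fun j => m (j + N)%N) m0.
  move=> h bh; have := seq_weakly_cvg hr mE bh.
  by rewrite -(cvg_shiftn N).
suff : \int[m (j + N)%N]_x (w \_ D) x @[j --> \oo] --> \int[m0]_x psi x.
  by rewrite (cvg_shiftn N (fun j => \int[m j]_x (w \_ D) x)).
apply: (strong_limit_mean (C := C) wmr p1 mwD ipsi).
  by move=> j; rewrite mE; apply: wC; apply: hN; exact: leq_addl.
move=> a b eps delta ab eps0 delta0.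
have [j0 [U [oU [subU hU]]]] := phisS a b eps delta ab eps0 delta0.
have mU := open_measurable_Bn oU.
exists j0, U; split => //.
  have mA : measurable ([set x | a <= psi x < b] : set B).
    rewrite (_ : [set _ | _] = [set x | a <= psi x] `&` [set x | psi x < b]).
      by apply: measurableI; [exact: measurable_set_le|exact: measurable_set_lt].
    by apply/seteqP; split => x /=; [move/andP|move=> [? ?]; apply/andP].
  apply: (@measure0_subset _ _ _ m0 _ (~` supp mu `|` (N1 `|` N2))).
  - exact: measurableD.
  - by apply: measurableU; [apply: measurableC; exact: measurable_supp|exact: measurableU].
  - move=> x [/= ax nU]; apply: contrapT => /not_orP[/contrapT sx /not_orP[n1 n2]].
    by apply: nU; apply: subU; split => //; rewrite phisE// upsiE.
  have z : m0.-negligible (~` supp mu `|` (N1 `|` N2)).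
    rewrite m0E; apply: negligibleU.
      apply/negligibleP; last exact: supp_conull.
      by apply: measurableC; exact: measurable_supp.
    by apply: negligibleU; apply/negligibleP.
  apply/negligibleP => //.
  by apply: measurableU; [apply: measurableC; exact: measurable_supp|exact: measurableU].
move=> j jj; have rj : r (j + N)%N < 0 by case: hr.
have jN : (j0 <= j + N)%N by exact: leq_trans (leq_addr _ _).
apply: le_lt_trans (hU _ jN); rewrite mE.
have sD := supp_subD rj.
have ms := measurable_supp (mur (r (j + N)%N)).
(* The measure is carried by its support, which lies in [D], where [w] and its extension agree. *)
have key (A A' : set V) : measurable (A' : set B) ->
    (forall x, D x -> A x <-> A' x) ->
    (mur (r (j + N)%N) (U `&` A') <= mur (r (j + N)%N)
      (supp (mur (r (j + N)%N)) `&` (U `&` closure D) `&` A))%E.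
  move=> mA' AA'.
  have E1 : supp (mur (r (j + N)%N)) `&` (U `&` closure D) `&` A =
      supp (mur (r (j + N)%N)) `&` (U `&` A').
    apply/seteqP; split => x.
      by move=> [[sx [Ux _]] Ax]; split => //; split => //; apply/(AA' x (sD x sx)).
    move=> [sx [Ux Ax]]; split; last by apply/(AA' x (sD x sx)).
    by split => //; split => //; apply: subset_closure; exact: sD.
  rewrite E1; have mUA : measurable (U `&` A' : set B) by exact: measurableI.
  apply: (@le_trans _ _ (mur (r (j + N)%N) ((supp (mur (r (j + N)%N)) `&` (U `&` A')) `|`
      ~` supp (mur (r (j + N)%N))))).
    apply: le_measure; rewrite ?inE//.
      by apply: measurableU; [exact: measurableI|exact: measurableC].
    move=> x UAx; have [sx|nsx] := pselect (supp (mur (r (j + N)%N)) x); last by right.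
    by left.
  apply: (le_trans (measureU2 _ _ _)).
  - exact: measurableI.
  - exact: measurableC.
  - by rewrite [X in (_ + X)%E]supp_conull adde0.
apply: leeD; apply: key.
- exact: measurable_set_lt.
- by move=> x Dx /=; rewrite patchE mem_set.
- exact: measurable_set_lt.
- by move=> x Dx /=; rewrite patchE mem_set.
Qed.

(** Test functions on the compact set [closure D] are extended by Tietze, and integrals over
    supports become integrals over the whole space. The last conclusion is the test function 1, the
    form in which means are compared. *)
Lemma weak_limit_subsequence (u : V -> R) (r : nat -> R)
    (m : nat -> {finite_measure set B -> \bar R}) :
  measurable_fun (D : set B) (u : B -> R) -> (norm_p Dr mur p u < +oo)%E ->
  seq_to0 r -> (forall j, (m j : set B -> \bar R) = mur (r j)) ->
  exists2 phi : nat -> nat, {homo phi : i j / (i < j)%N} &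
  exists psi : V -> R, [/\ measurable_fun setT (psi : B -> R),
    m0.-integrable setT (EFin \o (psi : B -> R)), in_Lp mu p psi,
    weak_limit D mur mu (r \o phi) (fun=> u) psi &
    \int[m (phi j)]_x (u \_ D) x @[j --> \oo] --> \int[m0]_x psi x].
Proof.
move=> mu' nu hr mE.
have [e [C [e0 uC]]] := norm_p_bound mu' nu.
have [N hN] := seq_near hr e0.
have muD := measurable_patch oD mu'.
have wmr : weakly_cvg (fun j => m (j + N)%N) m0.
  move=> h bh; have := seq_weakly_cvg hr mE bh.
  by rewrite -(cvg_shiftn N).
have uCj j : (\int[m (j + N)%N]_x (`|(u \_ D) x| `^ p)%:E <= C%:E)%E.
  by rewrite mE; apply: uC; apply: hN; exact: leq_addl.
have [phi inc [psi [mpsi ipsi pL hpsi]]] := weak_compactness wmr p1 muD uCj.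
exists (fun j => (phi j + N)%N).
  by move=> i j ij; rewrite ltn_add2r; exact: inc.
have b1 : bcont (fun _ : V => 1 : R).
  by split; [exact: cts_cst|exists 1 => x; rewrite normr1].
exists psi; split => //.
- split; first exact: measurable_funTS.
  rewrite -m0E ge0_integral_conull//.
  - exact: measurable_supp.
  - by rewrite -[LHS]/((m0 : set B -> \bar R) (~` supp mu)) m0E supp_conull.
  - apply/measurable_EFinP; apply: (measurableT_comp (measurable_powR p)).
    exact: measurableT_comp.
- have sE j : {in supp (mur (r (phi j + N)%N)), (u \_ D) =1 u}.
    move=> x /set_mem sx; rewrite patchE mem_set//.
    by apply: supp_subD sx; case: hr.
  split; last split.
  + rewrite -m0E; apply: integrableS ipsi => //; exact: measurable_supp.
  + move=> j /=; have [i1 _ _] := pintegrable p1 muD (uCj (phi j)).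
    apply: (@eq_integrable _ _ _ _ _ _ (EFin \o (u \_ D : B -> R))).
    * exact: measurable_supp.
    * by move=> x sx /=; rewrite (sE j).
    * by rewrite -mE; apply: integrableS i1 => //; exact: measurable_supp.
  + move=> h ch; have [g bg hg] := bcont_extension (bounded_closure_compact hDb) ch.
    have -> : (\int[mu]_(x in (supp mu : set B)) (h x * psi x)%:E =
        (\int[m0]_x (g x * psi x))%:E)%E.
      rewrite fineK; last by apply: (integrable_fin_num measurableT); exact: integrable_bcont_mul.
      rewrite -(@integral_conull _ _ _ m0 (supp mu)).
      - rewrite -m0E; apply: eq_integral => x /set_mem sx; rewrite hg//.
        have cK : closed (closure D) by exact: closed_closure.
        exact: supp_sub cK mu_KC _ sx.
      - exact: measurable_supp.
      - by rewrite -[LHS]/((m0 : set B -> \bar R) (~` supp mu)) m0E supp_conull.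
      - exact: integrable_bcont_mul.
    have hj j : (\int[mur (r (phi j + N)%N)]_(x in (supp (mur (r (phi j + N)%N)) : set B))
        (h x * u x)%:E = (\int[m (phi j + N)%N]_x (g x * (u \_ D) x))%:E)%E.
      have [i1 _ _] := pintegrable p1 muD (uCj (phi j)).
      have ig := integrable_bcont_mul bg i1.
      rewrite fineK; last exact: (integrable_fin_num measurableT).
      rewrite -(@integral_conull _ B R (m (phi j + N)%N) (supp (mur (r (phi j + N)%N)))).
      - rewrite -mE; apply: eq_integral => x sx; rewrite (sE j)// hg//.
        have rj : r (phi j + N)%N < 0 by case: hr.
        apply: subset_closure; exact: (supp_subD rj (set_mem sx)).
      - exact: measurable_supp.
      - by rewrite -[LHS]/((m (phi j + N)%N : set B -> \bar R) _) mE supp_conull.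
      - exact: ig.
    under eq_fun do rewrite hj.
    by apply: cvg_EFin; [exact: nearW|exact: hpsi].
- have := hpsi _ b1; under eq_fun do under eq_Rintegral do rewrite mul1r.
  by under eq_Rintegral do rewrite mul1r.
Qed.

Lemma limit_mean_le (v w : V -> R) (r : nat -> R)
    (m : nat -> {finite_measure set B -> \bar R}) (l l' : R) :
  measurable_fun (D : set B) (v : B -> R) -> measurable_fun (D : set B) (w : B -> R) ->
  (norm_p Dr mur p v < +oo)%E -> (norm_p Dr mur p w < +oo)%E ->
  (forall z, D z -> v z <= w z) ->
  seq_to0 r -> (forall j, (m j : set B -> \bar R) = mur (r j)) ->
  \int[m j]_x (v \_ D) x @[j --> \oo] --> l ->
  \int[m j]_x (w \_ D) x @[j --> \oo] --> l' -> l <= l'.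
Proof.
move=> mv mw nv nw vw hr mE cv cw.
have [e1 [C1 [e10 vC]]] := norm_p_bound mv nv.
have [e2 [C2 [e20 wC]]] := norm_p_bound mw nw.
have [N1 hN1] := seq_near hr e10; have [N2 hN2] := seq_near hr e20.
have mvD := measurable_patch oD mv; have mwD := measurable_patch oD mw.
apply: (ler_cvg_to cv cw); exists (maxn N1 N2) => // j /=.
rewrite geq_max => /andP[jN1 jN2].
have [iv _ _] : [/\ (m j).-integrable setT (EFin \o (v \_ D : B -> R)), 
    (m j).-integrable setT (EFin \o (fun x : B => `|(v \_ D) x| `^ p)) &
    \int[m j]_x (`|(v \_ D) x| `^ p) <= C1].
  by apply: pintegrable => //; rewrite mE; apply: vC; exact: hN1.
have [iw _ _] : [/\ (m j).-integrable setT (EFin \o (w \_ D : B -> R)), 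
    (m j).-integrable setT (EFin \o (fun x : B => `|(w \_ D) x| `^ p)) &
    \int[m j]_x (`|(w \_ D) x| `^ p) <= C2].
  by apply: pintegrable => //; rewrite mE; apply: wC; exact: hN2.
apply: le_Rintegral => // x _.
by rewrite !patchE; case: ifPn => // /set_mem; exact: vw.
Qed.

Lemma boundary_values_sandwich (u w ustar : V -> R) :
  measurable_fun (D : set B) (u : B -> R) -> measurable_fun (D : set B) (w : B -> R) ->
  (norm_p Dr mur p u < +oo)%E -> (norm_p Dr mur p w < +oo)%E ->
  (forall z, D z -> u z <= w z) ->
  (forall (r : nat -> R) (m : nat -> {finite_measure set B -> \bar R}), seq_to0 r ->
    (forall j, (m j : set B -> \bar R) = mur (r j)) ->
    \int[m j]_x (w \_ D) x - \int[m j]_x (u \_ D) x @[j --> \oo] --> (0 : R)) ->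
  is_boundary_values D mur mu w ustar -> is_boundary_values D mur mu u ustar.
Proof.
move=> mu' mw nu nw uw wu0 [mustar bw]; split => // r hr.
have [phis [[mphis phisS] phisu]] := bw r hr.
exists phis; split => //; split => // a b eps delta ab eps0 delta0.
have eps2 : 0 < eps / 2 by rewrite divr_gt0.
have delta2 : 0 < delta / 2 by rewrite divr_gt0.
have [j0 [U [oU [subU hU]]]] := phisS a b _ _ ab eps2 delta2.
have [m mE] := seq_finite_measures hr.
have [e1 [C1 [e10 uC]]] := norm_p_bound mu' nu.
have [e2 [C2 [e20 wC]]] := norm_p_bound mw nw.
have [N1 hN1] := seq_near hr e10; have [N2 hN2] := seq_near hr e20.
have muD := measurable_patch oD mu'; have mwD := measurable_patch oD mw.
(* A mean of [w - u] below this product gives, by Markov at level [eps / 4], mass at most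
   [delta / 4]. *)
have d4 : 0 < eps / 4 * (delta / 4) by rewrite mulr_gt0 ?divr_gt0.
have /cvgrPdist_le/(_ _ d4)[N3 _ hN3] := wu0 r m hr mE.
exists (maxn j0 (maxn N1 (maxn N2 N3))), U; split => //; split => // j.
rewrite !geq_max => /and4P[jj0 jN1 jN2 jN3].
have rj : r j < 0 by case: hr.
have [iu _ _] : [/\ (m j).-integrable setT (EFin \o (u \_ D : B -> R)), 
    (m j).-integrable setT (EFin \o (fun x : B => `|(u \_ D) x| `^ p)) &
    \int[m j]_x (`|(u \_ D) x| `^ p) <= C1].
  by apply: pintegrable => //; rewrite mE; apply: uC; exact: hN1.
have [iw _ _] : [/\ (m j).-integrable setT (EFin \o (w \_ D : B -> R)), 
    (m j).-integrable setT (EFin \o (fun x : B => `|(w \_ D) x| `^ p)) &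
    \int[m j]_x (`|(w \_ D) x| `^ p) <= C2].
  by apply: pintegrable => //; rewrite mE; apply: wC; exact: hN2.
have uwD x : (u \_ D) x <= (w \_ D) x.
  by rewrite !patchE; case: ifPn => // /set_mem; exact: uw.
pose E : set B := [set x | eps / 4 <= `|(w \_ D) x - (u \_ D) x|].
have mE' : measurable E by exact: measurable_dist_ge.
have hE : fine (m j E) <= delta / 4.
  have eps4 : 0 < eps / 4 by rewrite divr_gt0.
  rewrite -(ler_pM2l eps4).
  apply: (le_trans (@Rintegral_markov _ B R (m j) (fun x => (w \_ D) x - (u \_ D) x) _ eps4
    (integrableB measurableT iw iu))).
  under eq_Rintegral do rewrite ger0_norm ?subr_ge0//.
  rewrite RintegralB//; have := hN3 j jN3; rewrite /= sub0r normrN.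
  by apply: le_trans; exact: ler_norm.
have hEE : (mur (r j) E <= (delta / 4)%:E)%E.
  by rewrite -mE -[leLHS]fineK ?lee_fin// fin_num_measure.
have sD := supp_subD rj.
set S := supp (mur (r j)) `&` (U `&` closure D) in hU *.
have mS : measurable (S : set B).
  apply: measurableI; first exact: measurable_supp.
  by apply: measurableI => //; exact: open_measurable_Bn.
have SD x : S x -> D x by move=> [sx _]; exact: sD.
(* [u] and [w] are measurable on [D] only; since [S] lies in [D], their level sets within [S] are
   those of the extensions. *)
have meas (A A' : set V) : measurable (A' : set B) ->
    (forall x, D x -> A x <-> A' x) -> measurable (S `&` A : set B).
  move=> mA' AA'; rewrite (_ : S `&` A = S `&` A'); first exact: measurableI.
  by apply/seteqP; split => x [Sx /(AA' x (SD x Sx))].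
have m1 c : measurable (S `&` [set x | u x < c] : set B).
  apply: (meas _ [set x | (u \_ D) x < c]); first exact: measurable_set_lt.
  by move=> x Dx /=; rewrite patchE mem_set.
have m2 c : measurable (S `&` [set x | c < u x] : set B).
  apply: (meas _ [set x | c < (u \_ D) x]); first exact: measurable_set_lt.
  by move=> x Dx /=; rewrite patchE mem_set.
have m3 c : measurable (S `&` [set x | w x < c] : set B).
  apply: (meas _ [set x | (w \_ D) x < c]); first exact: measurable_set_lt.
  by move=> x Dx /=; rewrite patchE mem_set.
have m4 c : measurable (S `&` [set x | c < w x] : set B).
  apply: (meas _ [set x | c < (w \_ D) x]); first exact: measurable_set_lt.
  by move=> x Dx /=; rewrite patchE mem_set.
(* Only the lower side needs [w - u] small: where [u < a - eps] and [w >= a - eps / 2], the gap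
   exceeds [eps / 2]. On the upper side [u <= w] suffices. *)
have h1 : (mur (r j) (S `&` [set x | (u x < a - eps)%R]) <=
    mur (r j) (S `&` [set x | (w x < a - eps / 2)%R]) + (delta / 4)%:E)%E.
  apply: (@le_trans _ _ (mur (r j) ((S `&` [set x | (w x < a - eps / 2)%R]) `|` E))).
    apply: le_measure; rewrite ?inE//; first exact: measurableU.
    move=> x [Sx /= ux]; have [wx|wx] := ltP (w x) (a - eps / 2); first by left.
    right; rewrite /E/= !patchE mem_set; last exact: SD.
    apply: le_trans (ler_norm _); lra.
  by apply: (le_trans (measureU2 _ _ _)) => //; rewrite leeD2l.
have h2 : (mur (r j) (S `&` [set x | (b + eps < u x)%R]) <=
    mur (r j) (S `&` [set x | (b + eps / 2 < w x)%R]))%E.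
  apply: le_measure; rewrite ?inE//.
  move=> x [Sx /= ux]; split => //=.
  by have := uw x (SD x Sx); lra.
apply: (le_lt_trans (leeD h1 h2)); rewrite addeAC.
rewrite (splitr delta) EFinD; apply: lte_leD => //.
  exact: hU.
by rewrite lee_fin; lra.
Qed.

End BoundaryValues.

Unset Implicit Arguments.

Theorem theorem5p1 (R : realType) (n : nat)
  (D : set 'rV[R]_n) (Dr : R -> set 'rV[R]_n)
  (mur : R -> {measure set (Bn R n) -> \bar R})
  (mu : {measure set (Bn R n) -> \bar R})
  (p : R) (P : 'rV[R]_n -> 'rV[R]_n -> R) (F : set ('rV[R]_n -> R))
  (* standing setting *)
  (hD : domain D) (hDb : bounded_set D)
  (hDr : forall r : R, r < 0 -> domain (Dr r))
  (hDrDs : forall r s : R, r < s -> s < 0 ->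
     compact (closure (Dr r)) /\ closure (Dr r) `<=` Dr s)
  (hDunion : \bigcup_(r in [set r : R | r < 0]) Dr r = D)
  (hmur_fin : forall r : R, r < 0 -> (mur r setT < +oo)%E)
  (hmur_supp : forall r : R, r < 0 -> mur r (~` bdry (Dr r)) = 0%E)
  (hmu_fin : (mu setT < +oo)%E)
  (hmu_supp : mu (~` bdry D) = 0%E)
  (hweak : forall h : 'rV[R]_n -> R, {within closure D, continuous h} ->
     (fun r : R => (\int[mur r]_(x in (closure D : set (Bn R n))) (h x)%:E)%E)
       @ (0:R)^'- --> (\int[mu]_(x in (closure D : set (Bn R n))) (h x)%:E)%E)
  (* hypotheses of the theorem *)
  (hp : 1 < p)
  (hPmeas : measurable_fun (D `*` bdry D : set (Bn R n * Bn R n))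
              (fun zw : Bn R n * Bn R n => P zw.1 zw.2))
  (hP1 : forall z, D z ->
     (\int[mu]_(x in (bdry D : set (Bn R n))) (P z x)%:E)%E = 1%E)
  (hP2 : forall h : 'rV[R]_n -> R, in_Lp mu p h ->
     (exists ustar, is_boundary_values D mur mu (Pop mu P h) ustar /\
        {ae mu, forall x : Bn R n, supp mu x -> ustar x = h x}) /\
     (norm_p Dr mur p (Pop mu P h) <= Lp_pow mu p h)%E)
  (hFcont : forall u, F u -> {within D, continuous u})
  (hFnorm : forall u, F u -> (norm_p Dr mur p u < +oo)%E)
  (hFP : forall u, F u -> forall r : nat -> R, seq_to0 r ->
     forall psi : 'rV[R]_n -> R, weak_limit D mur mu r (fun _ => u) psi ->
     forall z, D z -> u z <= Pop mu P psi z) :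
  forall u, F u -> has_boundary_values D mur mu u.
Proof.
move=> u Fu.
have [oD [_ _]] := hD.
have [m0 m0E] := finite_measure_of hmu_fin.
have mu_u := within_open_measurable oD (hFcont u Fu).
have nu := hFnorm u Fu.
(* The weak limit [psi] belongs to the one sequence [r], yet by (P2) the means of its Poisson
   integral converge along every sequence [s]. *)
have majorant (v : 'rV[R]_n -> R) (r : nat -> R) (psi : 'rV[R]_n -> R) : F v -> seq_to0 r ->
    measurable_fun setT (psi : Bn R n -> R) ->
    m0.-integrable setT (EFin \o (psi : Bn R n -> R)) -> in_Lp mu p psi ->
    weak_limit D mur mu r (fun=> v) psi ->
    [/\ forall z, D z -> v z <= Pop mu P psi z,
      measurable_fun (D : set (Bn R n)) (Pop mu P psi : Bn R n -> R),
      (norm_p Dr mur p (Pop mu P psi) < +oo)%E,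
      exists ustar, is_boundary_values D mur mu (Pop mu P psi) ustar &
      forall (s : nat -> R) (m : nat -> {finite_measure set (Bn R n) -> \bar R}),
        seq_to0 s -> (forall j, (m j : set (Bn R n) -> \bar R) = mur (s j)) ->
        \int[m j]_x (Pop mu P psi \_ D) x @[j --> \oo] --> \int[m0]_x psi x].
  move=> Fv hr mpsi ipsi psiL wl.
  have [[ustar [bw upsi]] nw] := hP2 psi psiL.
  have mw := measurable_Pop oD (@closed_bdry _ _ D) hmu_fin hmu_supp hPmeas mpsi.
  have {}nw : (norm_p Dr mur p (Pop mu P psi) < +oo)%E.
    by apply: (le_lt_trans nw); case: psiL.
  split => //; first exact: hFP Fv _ hr _ wl.
    by exists ustar.
  move=> s m hs mE.
  exact: (boundary_values_mean oD hDrDs hDunion hmur_supp m0E hmu_supp hweak hp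
    mw nw bw upsi mpsi ipsi hs mE).
have sub r m := @weak_limit_subsequence R n D Dr mur mu p m0 oD hDb hDrDs hDunion
  hmur_supp m0E hmu_supp hweak hp u r m mu_u nu.
(* A concrete sequence from which the reference function [psi] is extracted. *)
pose r0 (j : nat) : R := - j.+1%:R^-1.
have hr0 : seq_to0 r0.
  split; first by move=> j; rewrite oppr_lt0 invr_gt0.
  split; first by move=> i j ij; rewrite lerN2 lef_pV2 ?posrE// ler_nat ltnS.
  by rewrite -[X in _ --> X]oppr0; apply: cvgN; exact: cvg_harmonic.
have [m mE] := seq_finite_measures hmur_fin hr0.
have [phi inc [psi [mpsi ipsi psiL wl cu]]] := sub r0 m hr0 mE.
have hr0phi := seq_to0_comp inc hr0.
have [uw mw nw [ustar bw] cw] := majorant u _ psi Fu hr0phi mpsi ipsi psiL wl.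
exists ustar.
apply: (boundary_values_sandwich oD hDrDs hDunion hmur_fin hmur_supp hp
  mu_u mw nu nw uw _ bw).
move=> r k hr kE.
(* The means of [Pop mu P psi] along [r] have this same limit, so the means of the difference tend
   to 0. *)
suff cur : \int[k j]_x (u \_ D) x @[j --> \oo] --> \int[m0]_x psi x.
  by rewrite -(subrr (\int[m0]_x psi x)); apply: cvgB => //; exact: cw hr kE.
apply: subsubsequence_cvg => s sinc.
have hrs := seq_to0_comp sinc hr.
have kEs j : ((k \o s) j : set (Bn R n) -> \bar R) = mur ((r \o s) j) by exact: kE.
have [t tinc [psi' [mpsi' ipsi' psiL' wl' cu']]] := sub (r \o s) (k \o s) hrs kEs.
exists t => //.
have hrst := seq_to0_comp tinc hrs.
have [uw' mw' nw' _ cw'] := majorant u _ psi' Fu hrst mpsi' ipsi' psiL' wl'.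
suff -> : \int[m0]_x psi x = \int[m0]_x psi' x by [].
have le_mean := @limit_mean_le R n D Dr mur p oD hDrDs hDunion hmur_supp hp u.
apply/eqP; rewrite eq_le; apply/andP; split.
(* [u <= Pop mu P psi'] along the reference sequence, where the means of [u] tend to the integral of
   [psi]; the other inequality exchanges the two sequences. *)
- apply: (le_mean (Pop mu P psi') (r0 \o phi) (m \o phi)) => //.
  + by move=> j; exact: mE.
  + exact: (cw' (r0 \o phi) (m \o phi) hr0phi (fun j => mE (phi j))).
- apply: (le_mean (Pop mu P psi) (r \o s \o t) (k \o s \o t)) => //.
  + by move=> j; exact: kE.
  + exact: (cw (r \o s \o t) (k \o s \o t) hrst (fun j => kE (s (t j)))).
Qed.
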